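(* Let $\varepsilon>0$, $\eta>0$, $y_0\in L^2(\Omega)$ and $\rho_0\in\mathcal R$. For any $r>0$, let $\varphi^0\in\Phi_\varepsilon$ be the unique solution of $$a_{\varepsilon,r}(\varphi^0,\overline\varphi)=l(\overline\varphi)\qquad\forall\,\overline\varphi\in\Phi_\varepsilon,$$ and let $J^{\star\star}_{\varepsilon,r}:L^2(Q_T)\to\mathbb R$ be the functional defined by $$J^{\star\star}_{\varepsilon,r}(\lambda)=\tfrac12\iint_{Q_T}(\mathcal A_{\varepsilon,r}\lambda)\,\lambda\,dx\,dt-b(\varphi^0,\lambda).$$ Then $$\sup_{\lambda\in L^2(Q_T)}\ \inf_{\varphi\in\Phi_\varepsilon}\mathcal L_{\varepsilon,r}(\varphi,\lambda)=-\inf_{\lambda\in L^2(Q_T)}J^{\star\star}_{\varepsilon,r}(\lambda)+\mathcal L_{\varepsilon,r}(\varphi^0,0).$$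
   Context: $\Omega\subset\mathbb R^N$ is a bounded connected open set with sufficiently regular boundary (for instance $C^2$), $\omega\subset\Omega$ is a nonempty open subset, $T>0$; for $\tau>0$, $Q_\tau=\Omega\times(0,\tau)$, $q_\tau=\omega\times(0,\tau)$, $\Sigma_\tau=\partial\Omega\times(0,\tau)$. The coefficients satisfy $c=(c_{i,j})\in C^1(\overline\Omega;\mathcal M_N(\mathbb R))$ with $(c(x)\xi,\xi)\ge c_0|\xi|^2$ in $\overline\Omega$ for some $c_0>0$, and $d\in L^\infty(Q_T)$. Set $$L^\star\varphi=-\varphi_t-\nabla\cdot(c(x)\nabla\varphi)+d(x,t)\varphi.$$ For a fixed real $\rho_\star>0$, $\mathcal R=\{w\in C(Q_T):\ w\ge\rho_\star \text{ in }Q_T,\ w\in L^\infty(Q_{T-\delta})\ \forall\delta>0\}$. Let $\Phi_\varepsilon$ be the completion of $\Phi^0=\{\varphi\in C^2(\overline{Q_T}):\varphi=0\text{ on }\Sigma_T\}$ for the scalar product $$(\varphi,\overline\varphi)_{\Phi_\varepsilon}=\iint_{q_T}\rho_0^{-2}\varphi\,\overline\varphi\,dx\,dt+\varepsilon(\varphi(\cdot,T),\overline\varphi(\cdot,T))_{L^2(\Omega)}+\eta\iint_{Q_T}L^\star\varphi\,L^\star\overline\varphi\,dx\,dt.$$ For $\varphi\in\Phi_\varepsilon$, the quantities $\varphi(\cdot,T),\varphi(\cdot,0)\in L^2(\Omega)$ and $L^\star\varphi\in L^2(Q_T)$ are understood by continuous extension (using standard energy estimates). Define $$a_{\varepsilon,r}(\varphi,\overline\varphi)=\iint_{q_T}\rho_0^{-2}\varphi\,\overline\varphi\,dx\,dt+\varepsilon(\varphi(\cdot,T),\overline\varphi(\cdot,T))_{L^2(\Omega)}+r\iint_{Q_T}L^\star\varphi\,L^\star\overline\varphi\,dx\,dt,$$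 $$b(\varphi,\lambda)=-\iint_{Q_T}L^\star\varphi\,\lambda\,dx\,dt,\qquad l(\varphi)=-(y_0,\varphi(\cdot,0))_{L^2(\Omega)},$$ $$\mathcal L_{\varepsilon,r}(\varphi,\lambda)=\tfrac12a_{\varepsilon,r}(\varphi,\varphi)+b(\varphi,\lambda)-l(\varphi),\qquad(\varphi,\lambda)\in\Phi_\varepsilon\times L^2(Q_T).$$ The linear operator $\mathcal A_{\varepsilon,r}:L^2(Q_T)\to L^2(Q_T)$ is defined by $\mathcal A_{\varepsilon,r}\lambda=L^\star\varphi$, where $\varphi\in\Phi_\varepsilon$ is the unique solution of $a_{\varepsilon,r}(\varphi,\overline\varphi)=-b(\overline\varphi,\lambda)$ for all $\overline\varphi\in\Phi_\varepsilon$. *)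

(* Defs.v *)
From HB Require Import structures.
From mathcomp Require Import all_boot all_order all_algebra.
From mathcomp Require Import all_classical all_reals all_analysis.
Set Implicit Arguments.
Unset Strict Implicit.
Unset Printing Implicit Defensive.
Import Order.TTheory GRing.Theory Num.Theory.
Import numFieldNormedType.Exports.
Local Open Scope classical_set_scope.
Local Open Scope ring_scope.

(* 'rV[T]_n carries the product sigma-algebra, as n.-tuple T does in
   measurable_structure.v; for T = R this is the Borel sigma-algebra of R^n. *)
Definition measure_rV_display : measure_display -> measure_display.
Proof. exact. Qed.

Section measurable_rV.
Context {d} {T : measurableType d} (n : nat).

Let coord (i : 'I_n) (v : 'rV[T]_n) : T := v 0 i.

Let rV_set0 : g_sigma_preimage coord set0.
Proof. exact: sigma_algebra0. Qed.

Let rV_setC A : g_sigma_preimage coord A -> g_sigma_preimage coord (~` A).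
Proof. exact: sigma_algebraC. Qed.

Let rV_bigcup (F : _^nat) : (forall i, g_sigma_preimage coord (F i)) ->
  g_sigma_preimage coord (\bigcup_i (F i)).
Proof. exact: sigma_algebra_bigcup. Qed.

HB.instance Definition _ := @isMeasurable.Build (measure_rV_display d)
  'rV[T]_n (g_sigma_preimage coord) rV_set0 rV_setC rV_bigcup.

End measurable_rV.

Section measurable_fun_rV.
Context {d d'} {T : measurableType d} {U : measurableType d'} (n : nat).

Lemma measurable_coord_rV (i : 'I_n) :
  measurable_fun [set: 'rV[T]_n] (fun v => v 0 i).
Proof.
move=> _ Y mY; rewrite setTI; apply: sub_sigma_algebra => /=.
rewrite -bigcup_seq/=; exists i => /=; first by rewrite mem_index_enum.
by exists Y => //; rewrite setTI.
Qed.

Lemma measurable_fun_rV (f : U -> 'rV[T]_n) :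
  (forall i, measurable_fun [set: U] (fun u => f u 0 i)) ->
  measurable_fun [set: U] f.
Proof.
move=> mf _ A; rewrite setTI => mA.
have : preimage_set_system [set: U] f (@measurable _ 'rV[T]_n) (f @^-1` A).
  by exists A => //; rewrite setTI.
rewrite -[X in preimage_set_system _ _ X _]/(g_sigma_preimage _).
rewrite -g_sigma_preimage_comp.
apply: smallest_sub; first exact: sigma_algebra_measurable.
case: n f mf A {mA} => [|m] f mf A; first by rewrite big_ord0.
rewrite -bigcup_mkord_ord; apply: bigcup_sub => i Ii.
by move=> B [C mC <-]; exact: mf.
Qed.

End measurable_fun_rV.

Section consrV.
Context {d} {T : measurableType d} (n : nat).

Definition cons_rV (p : T * 'rV[T]_n) : 'rV[T]_n.+1 :=
  \row_i if unlift ord0 i is Some j then p.2 0 j else p.1.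

Lemma cons_rV0 p : cons_rV p 0 ord0 = p.1.
Proof. by rewrite mxE unlift_none. Qed.

Lemma cons_rVS p i : cons_rV p 0 (lift ord0 i) = p.2 0 i.
Proof. by rewrite mxE liftK. Qed.

Lemma measurable_cons_rV : measurable_fun setT cons_rV.
Proof.
apply: measurable_fun_rV => i.
have [j ->|->] := unliftP ord0 i.
  under eq_fun do rewrite cons_rVS.
  exact: (measurableT_comp (measurable_coord_rV j) measurable_snd).
by under eq_fun do rewrite cons_rV0; exact: measurable_fst.
Qed.

Lemma measurable_behead_rV :
  measurable_fun setT (fun v : 'rV[T]_n.+1 => \row_i v 0 (lift ord0 i)).
Proof.
apply: measurable_fun_rV => i; under eq_fun do rewrite mxE.
exact: measurable_coord_rV.
Qed.

End consrV.


Section power_measure_step.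
Context {d} {T : measurableType d} {R : realType}.
Variables (mu : {sigma_finite_measure set T -> \bar R}) (n : nat).
Variable m : {sigma_finite_measure set 'rV[T]_n -> \bar R}.
Local Open Scope ereal_scope.

(* mu \x m carried from T * T^n to T^(n+1). *)
Definition cons_measure : set 'rV[T]_n.+1 -> \bar R :=
  pushforward (mu \x m) (@cons_rV _ _ n).

Let cons_measure0 : cons_measure set0 = 0.
Proof. by rewrite /cons_measure /pushforward preimage_set0 measure0. Qed.

Let cons_measure_ge0 A : 0 <= cons_measure A.
Proof. by rewrite /cons_measure /pushforward measure_ge0. Qed.

Let cons_measure_sigma_additive : semi_sigma_additive cons_measure.
Proof.
exact: (@measure_semi_sigma_additive _ _ _
  (measure_function_pushforward__canonical__measure_function_Measure
    (mu \x m) (@measurable_cons_rV _ T n))).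
Qed.

HB.instance Definition _ := isMeasure.Build _ _ _ cons_measure
  cons_measure0 cons_measure_ge0 cons_measure_sigma_additive.

Let cons_measure_sigma_finite : sigma_finite setT cons_measure.
Proof.
have /sigma_finiteP[F [TF ndF Foo]] := sigma_finiteT mu.
have /sigma_finiteP[G [TG ndG Goo]] := sigma_finiteT m.
have FG v : exists k, F k v.1 /\ G k v.2.
  have [i _ Fi] : (\bigcup_i F i) v.1 by rewrite -TF.
  have [j _ Gj] : (\bigcup_j G j) v.2 by rewrite -TG.
  exists (maxn i j); split.
    by move: Fi; exact/subsetPset/ndF/leq_maxl.
  by move: Gj; exact/subsetPset/ndG/leq_maxr.
pose g (v : 'rV[T]_n.+1) := (v ord0 ord0, \row_i v ord0 (lift ord0 i)).
have mg : measurable_fun setT g.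
  apply: measurable_fun_pair => //; last exact: measurable_behead_rV.
  exact: measurable_coord_rV.
exists (fun k => g @^-1` (F k `*` G k)).
  by apply/seteqP; split=> // v _; have [k ?] := FG (g v); exists k.
move=> k; have [mF Fk] := Foo k; have [mG Gk] := Goo k; split.
  rewrite -[X in measurable X]setTI; apply: mg => //; exact: measurableX.
rewrite /cons_measure /pushforward -comp_preimage.
rewrite [X in X @^-1` _](_ : _ = id); last first.
  apply/funext => -[x v] /=; rewrite /g cons_rV0; congr pair.
  by apply/rowP => i; rewrite mxE cons_rVS.
by rewrite preimage_id product_measure1E// lte_mul_pinfty// ge0_fin_numE.
Qed.

HB.instance Definition _ := Measure_isSigmaFinite.Build _ _ _ cons_measure
  cons_measure_sigma_finite.

End power_measure_step.

Fixpoint power_measure {d} {T : measurableType d} {R : realType}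
    (mu : {sigma_finite_measure set T -> \bar R}) (n : nat) :
    {sigma_finite_measure set 'rV[T]_n -> \bar R} :=
  match n with
  | 0 => \d_(point : 'rV[T]_0)
  | n'.+1 => cons_measure mu (power_measure mu n')
  end.

(* Together with sigma-finiteness, this determines power_measure. *)
Lemma power_measure_box {d} {T : measurableType d} {R : realType}
    (mu : {sigma_finite_measure set T -> \bar R}) (n : nat)
    (A : 'I_n -> set T) : (forall i, measurable (A i)) ->
  power_measure mu n [set v | forall i, A i (v 0 i)] =
  (\prod_(i < n) mu (A i))%E.
Proof.
elim: n A => [|n IH] A mA.
  by rewrite big_ord0 /= diracE mem_set// => -[].
rewrite big_ord_recl -IH//= /cons_measure /pushforward.
rewrite [X in (_ \x _)%E X](_ : _ =
    A ord0 `*` [set v : 'rV[T]_n | forall i, A (lift ord0 i) (v 0 i)]).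
  rewrite product_measure1E//.
  rewrite [X in measurable X](_ : _ = \bigcap_(i in [set: 'I_n])
      ((fun v : 'rV[T]_n => v 0 i) @^-1` A (lift ord0 i))).
    apply: fin_bigcap_measurable => // i _; rewrite -[X in measurable X]setTI.
    exact: measurable_coord_rV.
  by apply/seteqP; split => v /= Av i; [move=> _|]; exact: Av.
apply/seteqP; split => [[x v] /= Av|[x v] /= [Ax Av] i].
  split; first by have := Av ord0; rewrite cons_rV0.
  by move=> i; have := Av (lift ord0 i); rewrite cons_rVS.
have [j ->|->] := unliftP ord0 i; last by rewrite cons_rV0.
by rewrite cons_rVS.
Qed.

Definition lebesgue_rV (R : realType) (n : nat) :
    {sigma_finite_measure set 'rV[measurableTypeR R]_n -> \bar R} :=
  power_measure (@lebesgue_measure R) n.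

Definition lebesgue_xt (R : realType) (n : nat) :
    {measure set ('rV[measurableTypeR R]_n * measurableTypeR R)%type -> \bar R} :=
  (lebesgue_rV R n \x @lebesgue_measure R)%E.

Section Lp_on.
Context {dY} {Y : measurableType dY} {R : realType}.
Variables (mu : {measure set Y -> \bar R}) (D : set Y).

(* L^p(D): functions whose extension by zero is in the library's L^p; values
   outside D are irrelevant, and equality is equality a.e. on D. *)
Definition Lp_on (p : \bar R) : set (Y -> R) :=
  [set f | f \_ D \in Lfun mu p].

Definition L2 : set (Y -> R) := Lp_on 2%:E.

Definition cvg_L2 (f_ : nat -> Y -> R) (f : Y -> R) : Prop :=
  'N[mu]_2%:E[EFin \o ((f_ n \- f) \_ D)%R]%E @[n --> \oo] --> 0%E.

End Lp_on.

Section smoothness.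
Context {R : realType} {V : normedModType R}.
Implicit Types (U : set V) (f : V -> R).

Fixpoint Ck_on (k : nat) U f : Prop :=
  {in U, continuous f} /\
  if k is k'.+1 then
    forall v, {in U, forall x, derivable f x v} /\ Ck_on k' U ('D_v f)
  else True.

(* Membership of f|_U in C^k with all derivatives of order <= k extending
   continuously to closure U. *)
Fixpoint Ck_up_to (k : nat) U f : Prop :=
  (exists g : V -> R, {within closure U, continuous g} /\ {in U, f =1 g}) /\
  if k is k'.+1 then
    forall v, {in U, forall x, derivable f x v} /\ Ck_up_to k' U ('D_v f)
  else True.

(* f in C^k(closure U); 'D_v f is meaningful only on the open set U, whereas f
   itself has its own values on the boundary. *)
Definition Ck_closure (k : nat) U f : Prop :=
  {within closure U, continuous f} /\ Ck_up_to k U f.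

Definition boundary U : set V := closure U `\` U°.

(* Near each boundary point, U is the negativity set of a C^k function with
   nonvanishing differential. *)
Definition Ck_boundary (k : nat) U : Prop :=
  forall x, boundary U x -> exists (W : set V) (h : V -> R),
    [/\ open W, W x, Ck_on k W h, (exists v, 'D_v h x != 0)
      & U `&` W = [set y | W y /\ h y < 0]].

End smoothness.

(* (H, ipH) is a Hilbert space completing the subspace V0 of V for the scalar
   product ip, with canonical map iota; only the values of iota on V0 matter. *)
Record is_completion {R : realType} {V : lmodType R} (V0 : set V)
    (ip : V -> V -> R) (H : completeNormedModType R) (ipH : H -> H -> R)
    (iota : V -> H) : Prop := IsCompletion {
  completion_ipC : forall x y, ipH x y = ipH y x ;
  completion_ip_linear : forall a x y z,
    ipH (a *: x + y) z = a * ipH x z + ipH y z ;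
  completion_norm : forall x, `|x| ^+ 2 = ipH x x ;
  completion_linear : forall a f g, V0 f -> V0 g ->
    iota (a *: f + g) = a *: iota f + iota g ;
  completion_isometry : forall f g, V0 f -> V0 g ->
    ipH (iota f) (iota g) = ip f g ;
  completion_dense : closure (iota @` V0) = [set: H]
}.

Section control_problem.
Context {R : realType} {N : nat}.
Local Notation X := 'rV[R]_N.
Local Notation XT := ('rV[R]_N * R)%type.
Local Notation mux := (lebesgue_rV R N).
Local Notation muxt := (lebesgue_xt R N).

Definition cylinder (D : set X) (tau : R) : set XT := D `*` `]0, tau[%classic.

Definition lateral_boundary (D : set X) (tau : R) : set XT :=
  boundary D `*` `]0, tau[%classic.

Variables (Omega omega : set X) (T : R).
Local Notation Q := (cylinder Omega).
Local Notation q := (cylinder omega).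

Definition elliptic (c : X -> 'M[R]_N) (c0 : R) : Prop :=
  forall x, closure Omega x -> forall xi : 'cV[R]_N,
    c0 * \sum_i xi i 0 ^+ 2 <= \sum_i (c x *m xi) i 0 * xi i 0.

Definition weight_class (rho_star : R) (w : XT -> R) : Prop :=
  [/\ {in Q T, continuous w},
      {in Q T, forall z, rho_star <= w z}
    & forall delta, 0 < delta -> Lp_on muxt (Q (T - delta)) +oo%E w].

Variables (c : X -> 'M[R]_N) (d : XT -> R) (rho0 : XT -> R).

Definition d_t (phi : XT -> R) : XT -> R := 'D_((0, 1) : XT) phi.

Definition d_x (i : 'I_N) (phi : XT -> R) : XT -> R :=
  'D_((delta_mx 0 i, 0) : XT) phi.

Definition Lstar (phi : XT -> R) (z : XT) : R :=
  - d_t phi z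
  - \sum_i d_x i (fun w => \sum_j c w.1 i j * d_x j phi w) z
  + d z * phi z.

(* Elements are functions on all of R^N * R; two that agree on closure (Q T)
   have the same image in the completion. *)
Definition Phi0 : set (XT -> R) :=
  [set phi | Ck_closure 2 (Q T) phi /\
             forall z, lateral_boundary Omega T z -> phi z = 0].

Definition ip_Phi0 (eps eta : R) (phi psi : XT -> R) : R :=
  \int[muxt]_(z in q T) (rho0 z ^- 2 * phi z * psi z)
  + eps * \int[mux]_(x in Omega) (phi (x, T) * psi (x, T))
  + eta * \int[muxt]_(z in Q T) (Lstar phi z * Lstar psi z).

Variables (Phi : completeNormedModType R) (iota : (XT -> R) -> Phi).

(* Extension by continuity to Phi of a map op : Phi0 -> L^2(D): the common
   L^2(D)-limit of op along all sequences of Phi0 converging to phi. *)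
Definition extend {dY} {Y : measurableType dY} (mu : {measure set Y -> \bar R})
    (D : set Y) (op : (XT -> R) -> Y -> R) (phi : Phi) : Y -> R :=
  get [set g | L2 mu D g /\
    forall u : nat -> XT -> R, (forall n, Phi0 (u n)) ->
      iota (u n) @[n --> \oo] --> phi -> cvg_L2 mu D (fun n => op (u n)) g].

Definition ext_Lstar : Phi -> XT -> R := extend muxt (Q T) Lstar.

Definition ext_trace (t : R) : Phi -> X -> R :=
  extend mux Omega (fun phi x => phi (x, t)).

(* Restriction to q_T, where only rho0^-1 phi is controlled in L^2: the
   extension is taken in L^2(q_T; rho0^-2 dx dt). *)
Definition ext_q (phi : Phi) (z : XT) : R :=
  rho0 z * extend muxt (q T) (fun psi w => (rho0 w)^-1 * psi w) phi z.

Definition a_form (eps r : R) (phi psi : Phi) : R :=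
  \int[muxt]_(z in q T) (rho0 z ^- 2 * ext_q phi z * ext_q psi z)
  + eps * \int[mux]_(x in Omega) (ext_trace T phi x * ext_trace T psi x)
  + r * \int[muxt]_(z in Q T) (ext_Lstar phi z * ext_Lstar psi z).

Definition b_form (phi : Phi) (lambda : XT -> R) : R :=
  - \int[muxt]_(z in Q T) (ext_Lstar phi z * lambda z).

Definition l_form (y0 : X -> R) (phi : Phi) : R :=
  - \int[mux]_(x in Omega) (y0 x * ext_trace 0 phi x).

Definition Lagrangian (y0 : X -> R) (eps r : R) (phi : Phi)
    (lambda : XT -> R) : R :=
  2^-1 * a_form eps r phi phi + b_form phi lambda - l_form y0 phi.

Definition A_op (eps r : R) (lambda : XT -> R) : XT -> R :=
  ext_Lstar (get [set phi : Phi |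
    forall psi, a_form eps r phi psi = - b_form psi lambda]).

Definition J_dual (eps r : R) (phi0 : Phi) (lambda : XT -> R) : R :=
  2^-1 * \int[muxt]_(z in Q T) (A_op eps r lambda z * lambda z)
  - b_form phi0 lambda.

End control_problem.

(* Main.v *)
Require Import Defs.
From HB Require Import structures.
From mathcomp Require Import all_boot all_order all_algebra.
From mathcomp Require Import all_classical all_reals all_analysis.
From mathcomp Require Import ess_sup_inf measurable_realfun ring lra.
Set Implicit Arguments.
Unset Strict Implicit.
Unset Printing Implicit Defensive.
Import Order.TTheory GRing.Theory Num.Theory.
Import numFieldNormedType.Exports.
Local Open Scope classical_set_scope.
Local Open Scope ring_scope.

(** The key point is that, for each fixed [lambda], the Lagrangian is a
    quadratic function of [phi] whose minimum can be computed. The hypothesis on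
    [phi0] turns the linear form [l] into [a phi0 _]. If [p] solves [a p psi = - b psi lambda] for all [psi], then completing the
    square gives
      [L phi lambda
        = 1/2 a (phi - p - phi0) (phi - p - phi0) - 1/2 a (p + phi0) (p + phi0)],
    whose infimum is attained at [phi = p + phi0]. Since
    [A lambda = Lstar p], one has [1/2 (A lambda, lambda) = 1/2 a p p] and
    [- b phi0 lambda = a p phi0], so that the infimum is
    [L phi0 0 - J lambda] (lemmas [Lagrangian_square] and [Lagrangian_inf]).
    Taking the supremum over [lambda] gives the duality formula.

    What has to be established is that [a] is a symmetric bilinear form for which
    [p] exists. The three operators that enter [a] (the weighted restriction to
    [q_T], the trace at time [T] and [Lstar]) are linear maps from the smooth
    functions to L^2 spaces, and each is bounded by the norm of the completion
    because its squared L^2 norm is, up to a positive factor, a summand of the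
    squared norm of the space.
    L^2 spaces being complete ([L2_complete]), they extend by continuity
    ([extendP]), and inner products of extensions are limits of inner products
    of smooth functions ([extend_dot_cvg]); bilinearity is inherited in the
    limit although the extensions are chosen only up to null sets. In the same
    way the squared norm of the completion is the form [a] with [r = eta]
    ([normE]), so for every [r > 0] the form is bounded and coercive, and [p]
    is provided by the symmetric Lax-Milgram theorem ([symmetric_lax_milgram]).

    The regularity of the data is used to see that the operators do take values
    in L^2: a function with a continuous extension to the closure of a bounded
    open set is Borel and bounded, which covers every derivative occurring in
    [Lstar], and the weight [rho0] is bounded below by a positive constant; the
    product sigma-algebra contains the open sets by second countability
    ([open_measurable_xt]). *)

(** * Symmetric bilinear forms *)

Lemma quadratic_discriminant {R : realFieldType} (p b q : R) :
  (forall t, 0 <= p + 2 * t * b + t ^+ 2 * q) -> b ^+ 2 <= p * q.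
Proof.
move=> H; have p0 : 0 <= p by have := H 0; rewrite mulr0 mul0r expr0n mul0r !addr0.
have [q0|q0|q0] := ltgtP q 0.
- have [p1 q1] : 0 <= p / - q /\ - q > 0.
    by split; [rewrite divr_ge0// oppr_ge0 ltW|rewrite oppr_gt0].
  (* For q < 0 the polynomial is negative at this large s. *)
  pose s := p / - q + `|b| / - q * 2 + 1.
  have sE : - q * s = p + 2 * `|b| - q.
    by rewrite /s; field; rewrite lt_eqF.
  have b1 : b <= `|b| := ler_norm b.
  have s1 : 1 <= s by rewrite lerDr addr_ge0// mulr_ge0// divr_ge0// ltW.
  have := H s; nra.
- have := H (- b / q); have -> : p + 2 * (- b / q) * b + (- b / q) ^+ 2 * q =
      (p * q - b ^+ 2) / q by field; rewrite gt_eqF.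
  by rewrite pmulr_lge0 ?invr_gt0// subr_ge0.
- rewrite q0 mulr0; have [->|b0] := eqVneq b 0; first by rewrite expr0n.
  (* The affine function takes the value -1 at this point. *)
  have := H (- (p + 1) / (2 * b)); rewrite q0 mulr0 addr0.
  have -> : p + 2 * (- (p + 1) / (2 * b)) * b = -1 by field.
  by rewrite oppr_ge0 ler10.
Qed.

Section symmetric_bilinear.
Context {R : realType} {V : lmodType R}.
Variable a : V -> V -> R.
Hypothesis aC : forall x y, a x y = a y x.
Hypothesis aL : forall k x y z, a (k *: x + y) z = k * a x z + a y z.

Lemma bilinear_sqrD t x y :
  a (t *: x + y) (t *: x + y) = a y y + 2 * t * a x y + t ^+ 2 * a x x.
Proof.
rewrite aL [a x _]aC [a y (_ + _)]aC !aL [a y x]aC; ring.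
Qed.

Lemma bilinear_cauchy_schwarz : (forall x, 0 <= a x x) ->
  forall x y, a x y ^+ 2 <= a x x * a y y.
Proof.
move=> a0 x y; rewrite mulrC; apply: quadratic_discriminant => t.
by rewrite -bilinear_sqrD.
Qed.

End symmetric_bilinear.

(** Lax-Milgram theorem for a symmetric form, by the direct method: along a
    minimising sequence of the energy [a x x - 2 * l x] the parallelogram law
    turns near-minimality into the Cauchy property, and comparing the energy
    with its values on lines bounds the residual [a x y - l y]. *)
Theorem symmetric_lax_milgram {R : realType} (H : completeNormedModType R)
    (a : H -> H -> R) (l : H -> R) (alpha beta M : R) :
  (forall x y, a x y = a y x) ->
  (forall k x y z, a (k *: x + y) z = k * a x z + a y z) ->
  (forall k x y, l (k *: x + y) = k * l x + l y) ->
  0 < alpha -> 0 <= M ->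
  (forall x, alpha * `|x| ^+ 2 <= a x x) ->
  (forall x, a x x <= beta * `|x| ^+ 2) ->
  (forall x, l x ^+ 2 <= M * a x x) ->
  exists x, forall y, a x y = l y.
Proof.
move=> aC aL lL al0 M0 acoer abd lbd.
have a0 x : 0 <= a x x by apply: le_trans (acoer x); rewrite mulr_ge0// ltW.
pose F x := a x x - 2 * l x.
have F_lb x : - M <= F x.
  have := lbd x; have := a0 x; rewrite /F => h1 h2.
  have h3 : (2 * l x) ^+ 2 <= (M + a x x) ^+ 2 by have := sqr_ge0 (M - a x x); nra.
  have h4 : 2 * l x <= M + a x x.
    rewrite -[M + _]ger0_norm ?addr_ge0//; apply: (le_trans (ler_norm _)).
    by rewrite -ler_sqr ?nnegrE// !real_normK// num_real.
  lra.
have F_inf : has_inf (range F).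
  split; first by exists (F 0), 0.
  by exists (- M) => _ [x _ <-].
pose m := inf (range F).
have mF x : m <= F x by apply: ge_inf; [exact: F_inf.2|exists x].
have xex n : {x | F x < m + n.+1%:R^-1}.
  apply: cid; have [|_ [x _ <-] Fx] := @inf_adherent _ (range F) n.+1%:R^-1 _ F_inf.
    by rewrite invr_gt0.
  by exists x.
pose x_ n := sval (xex n).
have xP n : F (x_ n) < m + n.+1%:R^-1 by exact: (svalP (xex n)).
(* Parallelogram law applied to the midpoint of x_i and x_j. *)
have par i j : a (x_ i - x_ j) (x_ i - x_ j) <= 2 * i.+1%:R^-1 + 2 * j.+1%:R^-1.
  have aD x y z : a (x + y) z = a x z + a y z.
    by rewrite -{1}[x]scale1r aL mul1r.
  have aDr x y z : a x (y + z) = a x y + a x z by rewrite aC aD ![a _ x]aC.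
  have lD x y : l (x + y) = l x + l y by rewrite -{1}[x]scale1r lL mul1r.
  have aZ k y z : a (k *: y) z = k * a y z.
    by have := aL k y 0 z; have := aD 0 0 z; rewrite !addr0; lra.
  have aZr k y z : a y (k *: z) = k * a y z by rewrite aC aZ aC.
  have lZ k y : l (k *: y) = k * l y.
    by have := lL k y 0; have := lD 0 0; rewrite !addr0; lra.
  have h1 : a (x_ i - x_ j) (x_ i - x_ j) =
      a (x_ i) (x_ i) - 2 * a (x_ i) (x_ j) + a (x_ j) (x_ j).
    by rewrite -scaleN1r aD !aDr !(aZ, aZr) [a (x_ j) (x_ i)]aC; ring.
  have h2 : F (2^-1 *: (x_ i + x_ j)) =
      4^-1 * (a (x_ i) (x_ i) + 2 * a (x_ i) (x_ j) + a (x_ j) (x_ j)) -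
      (l (x_ i) + l (x_ j)).
    by rewrite /F aZ aZr aD !aDr lZ lD [a (x_ j) (x_ i)]aC; field.
  have := mF (2^-1 *: (x_ i + x_ j)); rewrite h2 h1.
  have := xP i; have := xP j; rewrite /F.
  by move: (i.+1%:R^-1) (j.+1%:R^-1) => u v; lra.
have small (e : R) : 0 < e -> \forall n \near \oo, n.+1%:R^-1 < e.
  by move=> e0; exact: (near_infty_natSinv_lt (PosNum e0)).
have xcvg : cvgn x_.
  apply/cauchy_cvgP/cauchy_ballP => e e0.
  have d0 : 0 < alpha * e ^+ 2 / 4 by rewrite divr_gt0// mulr_gt0// exprn_gt0.
  near_simpl; near=> i j.
  have Hi : i.+1%:R^-1 < alpha * e ^+ 2 / 4 by near: i; exact: small.
  have Hj : j.+1%:R^-1 < alpha * e ^+ 2 / 4 by near: j; exact: small.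
  rewrite -ball_normE/=.
  have h := le_trans (acoer _) (par i j).
  rewrite -ltr_sqr ?nnegrE ?(ltW e0)// -(ltr_pM2l al0).
  apply: (le_lt_trans h); move: Hi Hj.
  by move: (i.+1%:R^-1) (j.+1%:R^-1) => u v; lra.
exists (limn x_) => y; apply/eqP; rewrite -subr_eq0 -sqrf_eq0 eq_le sqr_ge0 andbT.
apply/ler_addgt0Pl => e e0; rewrite addr0.
(* C bounds the factor of e / C in the final estimate; 1 keeps it positive. *)
pose C := 2 * a y y + 2 * (`|beta| * a y y) + 1.
have b0 : 0 <= `|beta| := normr_ge0 _.
have by0 : 0 <= `|beta| * a y y by rewrite mulr_ge0.
have C0 : 0 < C by rewrite /C; have := a0 y; lra.
have eC : 0 < e / C by rewrite divr_gt0.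
have sq : 0 < Num.min 1 (e / C) by rewrite lt_min ltr01.
have [n [n1 n2]] : exists n, n.+1%:R^-1 < e / C /\
    `|limn x_ - x_ n| < Num.min 1 (e / C).
  near \oo => n; exists n; split; first by near: n; exact: small.
  near: n; have /cvgrPdist_lt := xcvg; exact.
set nn := n.+1%:R^-1 in n1.
(* The energy on the line through x_n directed by y is a quadratic polynomial
   with values at least m, hence has a nonpositive discriminant. *)
have res : (a (x_ n) y - l y) ^+ 2 <= nn * a y y.
  apply: quadratic_discriminant => t.
  have := mF (t *: y + x_ n); have := xP n; rewrite -/nn /F lL bilinear_sqrD//.
  by rewrite [a y (x_ n)]aC; lra.
have dist : a (limn x_ - x_ n) y ^+ 2 <= (`|beta| * a y y) * (e / C).
  apply: (le_trans (bilinear_cauchy_schwarz aC aL a0 _ _)).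
  rewrite [leRHS]mulrAC ler_wpM2r//.
  apply: (le_trans (abd _)).
  apply: (@le_trans _ _ (`|beta| * `|limn x_ - x_ n| ^+ 2)).
    by rewrite ler_wpM2r ?exprn_ge0// ler_norm.
  rewrite ler_wpM2l//.
  move: n2; rewrite lt_min => /andP[u1 u2].
  by apply: le_trans (ltW u2); rewrite expr2 ler_piMl// ltW.
have -> : a (limn x_) y - l y = a (limn x_ - x_ n) y + (a (x_ n) y - l y).
  have -> : limn x_ - x_ n = -1 *: x_ n + limn x_ by rewrite scaleN1r addrC.
  by rewrite aL; ring.
have nny : nn * a y y <= a y y * (e / C) by rewrite mulrC ler_wpM2l// ltW.
apply: (@le_trans _ _ ((2 * a y y + 2 * (`|beta| * a y y)) * (e / C))).
  move: (a (limn x_ - x_ n) y) (a (x_ n) y - l y) dist res nny => u v du dv dn.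
  by have := sqr_ge0 (u - v); lra.
rewrite -[leRHS](@divfK _ C) ?gt_eqF// mulrC ler_wpM2l// ?(ltW eC)//.
by rewrite /C lerDl.
Unshelve. all: by end_near.
Qed.

(** * The space L^2(D) *)

Section L2_theory.
Context {dY} {Y : measurableType dY} {R : realType}.
Variables (mu : {measure set Y -> \bar R}) (D : set Y).
Hypothesis mD : measurable D.
Local Notation L2D := (L2 mu D).
Implicit Types f g h : Y -> R.

Definition L2_dot f g : R := \int[mu]_(x in D) (f x * g x).
Definition L2_norm f : R := Num.sqrt (L2_dot f f).
Local Notation "<< f , g >>" := (L2_dot f g).

Lemma L2P f : L2D f <->
  measurable_fun D f /\ mu.-integrable D (fun x => (f x ^+ 2)%:E).
Proof.
have sqE : (fun x => ((f \_ D) x ^+ 2)%:E) = (fun x => (f x ^+ 2)%:E) \_ D.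
  by apply/funext => x; rewrite !patchE; case: ifP => // _; rewrite expr0n.
split=> [fL|[mf fi]].
  have /Lfun2_integrable_sqr := fL; rewrite /comp sqE => /(integrable_mkcond _ mD) ?.
  split=> //; apply/(measurable_restrictT _ mD).
  by have := sub_Lfun_mfun fL; rewrite inE.
rewrite /L2 /Lp_on/= /Lfun inE; apply/andP; split.
  by rewrite inE/=; apply/(measurable_restrictT _ mD).
rewrite inE/= /finite_norm unlock poweR_lty//.
move/(integrable_mkcond _ mD)/integrable_lty : fi; rewrite -sqE.
move=> /(_ measurableT); apply: le_lt_trans.
rewrite le_eqVlt; apply/orP; left; apply/eqP.
by apply: eq_integral => x _ /=; rewrite powR_mulrn// real_normK// num_real.
Qed.

Lemma L2_measurable f : L2D f -> measurable_fun D f.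
Proof. by case/L2P. Qed.

Lemma L2_eq f g : {in D, f =1 g} -> L2D f -> L2D g.
Proof.
move=> fg; rewrite /L2 /Lp_on/= (_ : g \_ D = f \_ D)//; apply/funext => x.
by rewrite !patchE; case: ifP => // xD; rewrite fg.
Qed.

Lemma L2_lin k f g : L2D f -> L2D g -> L2D (k *: f + g).
Proof.
move=> fL gL; have := (Lfun_submod_closed mu (lee1n 2)).2 k _ _ fL gL.
rewrite /L2 /Lp_on/= [X in _ -> X \in _](_ : _ = k *: f \_ D + g \_ D)//.
by apply/funext => x; rewrite /= !fctE !patchE; case: ifP => // _; rewrite scaler0 addr0.
Qed.

Lemma L2_ess_bounded f M : (mu D < +oo)%E -> measurable_fun D f ->
  {ae mu, forall x, D x -> `|f x| <= M} -> L2D f.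
Proof.
move=> Doo mf fM; apply/L2P; split=> //.
have mf2 : measurable_fun D (fun x => (f x ^+ 2)%:E).
  by apply/measurable_EFinP; exact: measurable_funX.
apply/integrableP; split => //.
apply: (@le_lt_trans _ _ ((`|M| ^+ 2)%:E * mu D)%E).
  apply: integral_le_bound => //.
  apply: filterS fM => x fM Dx; rewrite /= lee_fin normrX lerXn2r ?nnegrE//.
  exact: le_trans (fM Dx) (ler_norm _).
by rewrite lte_mul_pinfty// lee_fin exprn_ge0.
Qed.

(** If the whole space has measure zero, the L^oo norm is 0 whatever
    the function; any bound then holds almost everywhere. *)
Lemma Linfty_ess_bounded f : Lp_on mu D +oo%E f -> measurable_fun D f /\
  exists M, {ae mu, forall x, D x -> `|f x| <= M}.
Proof.
rewrite /Lp_on/= /Lfun inE => /andP[+ +]; rewrite !inE/= => mf fin.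
split; first exact/(measurable_restrictT _ mD).
have bound (M : R) : {ae mu, forall x, (`|(f \_ D) x|%:E <= M%:E)%E} ->
    {ae mu, forall x, D x -> `|f x| <= M}.
  by apply: filterS => x + Dx; rewrite patchE mem_set// lee_fin.
move: fin; rewrite /finite_norm unlock; case: ifPn => [_|mu0 _].
  have := ess_sup_ge mu (abse \o (EFin \o (f \_ D))).
  case: (ess_sup _ _) => [M h _|//|h _]; first by exists M; exact: bound.
  by exists 0; apply: bound; apply: filterS h => x; rewrite leeNy_eq.
exists 0; apply: bound; exists setT; split => //.
by apply/eqP; rewrite eq_le measure_ge0 andbT leNgt.
Qed.

Lemma L2_mul_integrable f g : L2D f -> L2D g ->
  mu.-integrable D (EFin \o (fun x => f x * g x)).
Proof.
move=> fL gL; apply/(integrable_mkcond _ mD).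
have /Lfun1_integrable := Lfun2_mul_Lfun1 fL gL.
rewrite [X in _ -> _.-integrable _ X](_ : _ = EFin \o (f \_ D \* g \_ D))//.
by apply/funext => x /=; rewrite !patchE; case: ifP => // _; rewrite mul0r.
Qed.

Lemma L2_dotC f g : <<f, g>> = <<g, f>>.
Proof. by apply: eq_Rintegral => x _; rewrite mulrC. Qed.

Lemma L2_dot_lin k f g h : L2D f -> L2D g -> L2D h ->
  <<k *: f + g, h>> = k * <<f, h>> + <<g, h>>.
Proof.
move=> fL gL hL; rewrite /L2_dot.
under eq_Rintegral => x _ do rewrite /= !fctE mulrDl -mulrA.
have fh := L2_mul_integrable fL hL; have gh := L2_mul_integrable gL hL.
rewrite RintegralD// ?RintegralZl//.
rewrite [X in _.-integrable _ X](_ : _ = (fun x => k%:E * (f x * h x)%:E)%E).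
  exact: (integrableZl mD k fh).
by apply/funext => x; rewrite /= EFinM.
Qed.

Lemma L2_dot_linr k f g h : L2D f -> L2D g -> L2D h ->
  <<h, k *: f + g>> = k * <<h, f>> + <<h, g>>.
Proof. by move=> fL gL hL; rewrite L2_dotC L2_dot_lin// !(L2_dotC h). Qed.

Lemma L2_dot_ge0 f : 0 <= <<f, f>>.
Proof. by apply: Rintegral_ge0 => x _; rewrite -expr2 sqr_ge0. Qed.

Lemma L2_dotE f : L2D f -> (<<f, f>>%:E = \int[mu]_(x in D) (f x ^+ 2)%:E)%E.
Proof.
move=> /L2P[mf fi]; rewrite /L2_dot /Rintegral fineK.
  by apply: eq_integral => x _; rewrite expr2.
rewrite (eq_integral (fun x => (f x ^+ 2)%:E)); last by move=> x _; rewrite expr2.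
exact: integrable_fin_num.
Qed.

Lemma L2_norm_sqr f : L2_norm f ^+ 2 = <<f, f>>.
Proof. by rewrite sqr_sqrtr// L2_dot_ge0. Qed.

Lemma L2_norm_ge0 f : 0 <= L2_norm f.
Proof. exact: sqrtr_ge0. Qed.

Lemma L2_cauchy_schwarz f g : L2D f -> L2D g ->
  `|<<f, g>>| <= L2_norm f * L2_norm g.
Proof.
move=> fL gL; rewrite -ler_sqr ?nnegrE ?mulr_ge0 ?L2_norm_ge0//.
rewrite real_normK ?num_real// exprMn !L2_norm_sqr mulrC.
apply: quadratic_discriminant => t.
have tL := L2_lin t fL gL.
have -> : <<g, g>> + 2 * t * <<f, g>> + t ^+ 2 * <<f, f>> =
    <<t *: f + g, t *: f + g>>.
  by rewrite L2_dot_lin// !L2_dot_linr// (L2_dotC g f); ring.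
exact: L2_dot_ge0.
Qed.

Lemma Lnorm2E f : L2D f ->
  ('N[mu]_2%:E[EFin \o (f \_ D)] = (L2_norm f)%:E)%E.
Proof.
move=> fL; rewrite unlock /L2_norm -powR12_sqrt ?L2_dot_ge0//.
rewrite -poweR_EFin L2_dotE// [in RHS]integral_mkcond; congr (_ `^ _)%E.
apply: eq_integral => x _ /=; rewrite !patchE.
by case: ifP => _; rewrite ?normr0 powR_mulrn// ?real_normK ?num_real// expr0n.
Qed.

Lemma cvg_L2P (u : nat -> Y -> R) g : (forall n, L2D (u n)) -> L2D g ->
  cvg_L2 mu D u g <-> L2_norm (u n - g) @[n --> \oo] --> (0 : R).
Proof.
move=> uL gL; rewrite /cvg_L2.
have E n : ('N[mu]_2%:E[EFin \o ((u n \- g) \_ D)%R] = (L2_norm (u n - g)%R)%:E)%E.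
  rewrite -Lnorm2E//.
  have -> : u n - g = -1 *: g + u n by rewrite scaleN1r addrC.
  exact: L2_lin.
rewrite (eq_cvg _ _ E); split; last by move=> h; apply/fine_cvgP; split => //; exact: nearW.
by move/fine_cvgP => [].
Qed.

End L2_theory.

Lemma geometric_increments_cvg {R : realType} (w : nat -> R) (C : R) :
  (forall k, `|w k.+1 - w k| <= C * 2^-1 ^+ k) -> cvgn w.
Proof.
move=> wC; have : cvgn (series (fun k => w k.+1 - w k)).
  apply: normed_cvg; apply: (@series_le_cvg _ _ (geometric C 2^-1)).
  - by move=> k; exact: normr_ge0.
  - by move=> k; exact: le_trans (wC k).
  - by move=> k; exact: wC.
  - by apply: is_cvg_geometric_series; rewrite ger0_norm; lra.
move=> /cvg_ex[l wl]; apply/cvg_ex; exists (l + w 0).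
have wE : w =1 (fun n => series (fun k => w k.+1 - w k) n + w 0).
  by move=> n; rewrite /series/= telescope_sumr// subrK.
by rewrite (eq_cvg _ _ wE); apply: cvgD => //; exact: cvg_cst.
Qed.

Section L2_complete.
Context {dY} {Y : measurableType dY} {R : realType}.
Variables (mu : {measure set Y -> \bar R}) (D : set Y).
Hypothesis mD : measurable D.
Local Notation L2D := (L2 mu D).
Local Notation L2_norm := (L2_norm mu D).
Local Notation "<< f , g >>" := (L2_dot mu D f g).
Implicit Types f g h : Y -> R.

Lemma L2_sub f g : L2D f -> L2D g -> L2D (f - g).
Proof.
by move=> fL gL; rewrite -[f - g]addrC -scaleN1r; exact: L2_lin.
Qed.

Lemma L2_normB_le f g h : L2D f -> L2D g -> L2D h ->
  L2_norm (f - h) <= L2_norm (f - g) + L2_norm (g - h).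
Proof.
move=> fL gL hL; have fgL := L2_sub fL gL; have ghL := L2_sub gL hL.
rewrite -ler_sqr ?nnegrE ?addr_ge0 ?L2_norm_ge0//.
have -> : f - h = 1 *: (f - g) + (g - h) by rewrite scale1r addrA subrK.
have L := L2_lin 1 fgL ghL.
rewrite sqrrD !L2_norm_sqr L2_dot_lin// !L2_dot_linr//.
rewrite (L2_dotC mu D (g - h) (f - g)).
have := le_trans (ler_norm _) (L2_cauchy_schwarz mD fgL ghL).
by move: (L2_norm (f - g) * _) => u; lra.
Qed.

Lemma cvg_L2_dot (u v : nat -> Y -> R) f g :
  (forall n, L2D (u n)) -> (forall n, L2D (v n)) -> L2D f -> L2D g ->
  cvg_L2 mu D u f -> cvg_L2 mu D v g ->
  <<u n, v n>> @[n --> \oo] --> <<f, g>>.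
Proof.
move=> uL vL fL gL /(cvg_L2P mD uL fL) uf /(cvg_L2P mD vL gL) vg.
have bd n : `|<<f, g>> - <<u n, v n>>| <=
    L2_norm (u n - f) * L2_norm (v n - g) + L2_norm (u n - f) * L2_norm g
    + L2_norm f * L2_norm (v n - g).
  have uL' := L2_sub (uL n) fL; have vL' := L2_sub (vL n) gL.
  have -> : <<f, g>> - <<u n, v n>> =
      - (<<u n - f, v n - g>> + <<u n - f, g>> + <<f, v n - g>>).
    have {1}-> : u n = 1 *: (u n - f) + f by rewrite scale1r subrK.
    have {1}-> : v n = 1 *: (v n - g) + g by rewrite scale1r subrK.
    by rewrite L2_dot_lin ?L2_dot_linr//; [ring|exact: L2_lin].
  rewrite normrN; apply: (le_trans (ler_normD _ _)); apply: lerD.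
    by apply: (le_trans (ler_normD _ _)); apply: lerD; exact: L2_cauchy_schwarz.
  exact: L2_cauchy_schwarz.
have h0 : L2_norm (u n - f) * L2_norm (v n - g) + L2_norm (u n - f) * L2_norm g
    + L2_norm f * L2_norm (v n - g) @[n --> \oo] --> (0 : R).
  rewrite (_ : 0 = 0 * 0 + 0 * L2_norm g + L2_norm f * 0); last by ring.
  apply: cvgD; last exact: cvgMr.
  by apply: cvgD; [exact: cvgM|exact: cvgMl].
apply/cvgrPdist_le => e e0; near=> n.
apply: (le_trans (bd n)); apply: (le_trans (ler_norm _)).
rewrite -[X in `|X|]subr0 distrC.
by near: n; move/cvgrPdist_le : h0; exact.
Unshelve. all: by end_near.
Qed.

(** Riesz-Fischer: a subsequence whose increments have squared L^2 norm at
    most [8^-k] converges almost everywhere because the weighted sum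
    [\sum_k 4^k |v_(k+1) - v_k|^2] is integrable, hence almost everywhere
    finite; Fatou's lemma makes its limit the limit in norm. *)
Lemma L2_complete (u : nat -> Y -> R) : (forall n, L2D (u n)) ->
  (forall e, 0 < e -> exists N, forall n m, (N <= n)%N -> (N <= m)%N ->
     <<u n - u m, u n - u m>> <= e) ->
  exists2 g, L2D g & cvg_L2 mu D u g.
Proof.
move=> uL uC.
have NP k : {N | forall n m, (N <= n)%N -> (N <= m)%N ->
    <<u n - u m, u n - u m>> <= 8^-1 ^+ k}.
  by apply: cid; apply: uC; rewrite exprn_gt0// invr_gt0.
pose N k := sval (NP k).
(* These indices need not increase strictly: only N i <= nk k for i <= k matters. *)
pose nk k := (\max_(i < k.+1) N i)%N.
have N_nk i k : (i <= k)%N -> (N i <= nk k)%N.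
  move=> ik; have := @leq_bigmax _ (fun j : 'I_k.+1 => N j) (inord i).
  by rewrite inordK.
pose v k := u (nk k).
have vL k : L2D (v k) by exact: uL.
pose G x := (\sum_(k <oo) (4 ^+ k * (v k.+1 x - v k x) ^+ 2)%:E)%E.
have term0 k x : (0 <= (4 ^+ k * (v k.+1 x - v k x) ^+ 2)%:E)%E.
  by rewrite lee_fin mulr_ge0 ?sqr_ge0// exprn_ge0.
have mv k : measurable_fun D (v k) := L2_measurable mD (vL k).
have mterm k : measurable_fun D (fun x => (4 ^+ k * (v k.+1 x - v k x) ^+ 2)%:E).
  apply/measurable_EFinP; apply: measurable_funM => //.
  by apply: measurable_funX; exact: measurable_funB.
have mG : measurable_fun D G by apply: ge0_emeasurable_sum.
have intG : (\int[mu]_(x in D) G x < +oo)%E.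
  rewrite integral_nneseries//.
  apply: (@le_lt_trans _ _ 2%:E); last by rewrite ltry.
  apply: lime_le.
    apply: is_cvg_nneseries => k _ _; exact: integral_ge0.
  apply: nearW => n.
  apply: (@le_trans _ _ (\sum_(0 <= k < n) (2^-1 ^+ k)%:E)%E).
    apply: lee_sum => k _.
    have dL := L2_sub (vL k.+1) (vL k).
    under eq_integral do rewrite EFinM.
    rewrite ge0_integralZl//; last 2 first.
    - by apply/measurable_EFinP/measurable_funX; exact: measurable_funB.
    - by move=> x _; rewrite lee_fin sqr_ge0.
    have := L2_dotE mD dL; rewrite !fctE => <-; rewrite -EFinM lee_fin.
    apply: (@le_trans _ _ (4 ^+ k * 8^-1 ^+ k)).
      by rewrite ler_wpM2l ?exprn_ge0//; apply: (svalP (NP k)); exact: N_nk.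
    by rewrite -exprMn (_ : 4 * 8^-1 = 2^-1)//; field.
  rewrite sumEFin lee_fin.
  have := @geometric_le_lim R n 1 2^-1 ler01; rewrite invr_gt0 ltr0n => /(_ isT).
  rewrite /series/= ger0_norm ?invr_ge0// invf_lt1// ltr1n => /(_ isT).
  under eq_bigr do rewrite mul1r.
  have -> : 1 - 2^-1 = 2^-1 :> R by field.
  by rewrite invrK mul1r.
pose E := D `&` [set x | (G x < +oo)%E].
have mE : measurable E.
  rewrite /E (_ : [set x | _] = G @^-1` [set y | (y < +oo)%E])//.
  by apply: mG => //; rewrite -[X in measurable X]setTI; exact: emeasurable_fun_infty_o.
have Gae : {ae mu, forall x, D x -> G x \is a fin_num}.
  apply: integrable_ae => //; apply/integrableP; split=> //.
  by under eq_integral do rewrite gee0_abs ?nneseries_ge0//.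
have vcvg x : E x -> cvgn (v ^~ x).
  move=> [Dx Gx]; have Gfin : G x \is a fin_num.
    by rewrite ge0_fin_numE// nneseries_ge0.
  apply: (@geometric_increments_cvg _ _ (Num.sqrt (fine (G x)))) => k.
  have G0 : 0 <= fine (G x) by rewrite fine_ge0// nneseries_ge0.
  rewrite -ler_sqr ?nnegrE ?mulr_ge0 ?sqrtr_ge0 ?exprn_ge0//.
  rewrite real_normK ?num_real// exprMn sqr_sqrtr// -exprM mulnC exprM.
  have -> : 2^-1 ^+ 2 = 4^-1 :> R by field.
  rewrite exprVn ler_pdivlMr ?exprn_gt0// mulrC -lee_fin fineK//.
  apply: le_trans (nneseries_lim_ge k.+1 _); last by [].
  rewrite big_nat_recr//= leeDr// sume_ge0//.
pose g := (fun x => limn (v ^~ x)) \_ E.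
have gE x : E x -> v ^~ x @ \oo --> g x.
  by move=> Ex; rewrite /g patchE mem_set//; exact: vcvg.
have mg : measurable_fun D g.
  apply: (@measurable_fun_cvg _ _ _ D (fun k => v k \_ E)) => [k|x Dx].
    by apply/measurable_restrict => //; apply: measurable_funS (mv k).
  rewrite /g patchE; case: ifPn => xE.
    under eq_fun do rewrite patchE xE; exact/vcvg/set_mem.
  by under eq_fun do rewrite patchE (negbTE xE); exact: cvg_cst.
(* Fatou's lemma along k, with u_n fixed. *)
have fat n m : (N m <= n)%N ->
    (\int[mu]_(x in D) ((u n x - g x) ^+ 2)%:E <= (8^-1 ^+ m)%:E)%E.
  move=> Nmn; pose h k x := ((u n x - v k x) ^+ 2)%:E.
  have mh k : measurable_fun D (h k).
    apply/measurable_EFinP/measurable_funX; apply: measurable_funB => //.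
    exact: L2_measurable.
  have mu_ : measurable_fun D (u n) by exact: L2_measurable.
  apply: (@le_trans _ _ (\int[mu]_(x in D) limn_einf (h ^~ x))%E).
    rewrite le_eqVlt; apply/orP; left; apply/eqP.
    apply: ge0_ae_eq_integral => //.
    - by apply/measurable_EFinP/measurable_funX; exact: measurable_funB.
    - apply: measurableT_comp => //.
      apply: measurable_fun_limn_esup => k; exact: measurableT_comp.
    - by move=> x _; rewrite lee_fin sqr_ge0.
    - move=> x _; rewrite limn_einf_lim; apply: lime_ge; first exact: is_cvg_einfs.
      apply: nearW => k; apply: le_ereal_inf_tmp => _ [j _ <-].
      by rewrite lee_fin sqr_ge0.
    apply: filterS Gae => x Gx Dx.
    have Ex : E x by split=> //=; rewrite ltey_eq Gx.
    have : h ^~ x @ \oo --> ((u n x - g x) ^+ 2)%:E.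
      apply/fine_cvgP; split; first exact: nearW.
      rewrite /comp/h/= !expr2; have := gE _ Ex => vg.
      by apply: cvgM; apply: cvgB => //; exact: cvg_cst.
    by move/cvg_limn_einf_sup => [->].
  apply: (le_trans (fatou _ _ mh _)) => //.
    by move=> k x _; rewrite lee_fin sqr_ge0.
  rewrite limn_einf_lim; apply: lime_le; first exact: is_cvg_einfs.
  apply: nearW => k; pose j := maxn k m.
  apply: (@le_trans _ _ (\int[mu]_(x in D) h j x)%E).
    by apply: ereal_inf_lbound; exists j => //=; exact: leq_maxl.
  have dL := L2_sub (uL n) (vL j).
  have := L2_dotE mD dL; rewrite !fctE => <-; rewrite lee_fin.
  by apply: (svalP (NP m)) => //; apply: N_nk; exact: leq_maxr.
have gL : L2D g.
  have dL : L2D (u (N 0%N) - g).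
    apply/(L2P mu mD); split; first by apply: measurable_funB => //; exact: L2_measurable.
    apply/integrableP; split.
      apply/measurable_EFinP/measurable_funX.
      by apply: measurable_funB => //; exact: L2_measurable.
    under eq_integral do rewrite gee0_abs ?lee_fin ?sqr_ge0//.
    by apply: (le_lt_trans (fat _ 0%N (leqnn _))); rewrite ltry.
  by rewrite -[g](subKr (u (N 0%N))); exact: L2_sub.
exists g => //; apply/(cvg_L2P mD uL gL).
apply/cvgrPdist_le => e e0.
have [m me] : exists m, 8^-1 ^+ m < e ^+ 2.
  have : (fun m => 8^-1 ^+ m : R) @ \oo --> (0 : R).
    by apply: cvg_expr; rewrite ger0_norm; lra.
  move=> /cvgrPdist_lt /(_ (e ^+ 2)); rewrite exprn_gt0// => /(_ isT) [m _ /(_ m)].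
  by rewrite /= leqnn sub0r normrN => /(_ isT) /ltr_normlW; exists m.
exists (N m) => // n /= Nmn.
rewrite sub0r normrN ger0_norm ?L2_norm_ge0// -ler_sqr ?nnegrE ?L2_norm_ge0 ?(ltW e0)//.
rewrite L2_norm_sqr -lee_fin (L2_dotE mD (L2_sub (uL n) gL)).
by apply: (le_trans (fat _ _ Nmn)); rewrite lee_fin ltW.
Qed.

End L2_complete.

(** * Extension of bounded operators to the completion *)

Section extension.
Context {R : realType} {N : nat}.
Local Notation XT := ('rV[R]_N * R)%type.
Variables (Omega : set 'rV[R]_N) (T : R).
Variables (H : completeNormedModType R) (iota : (XT -> R) -> H).
Local Notation V0 := (Phi0 Omega T).
Hypothesis V0_lin : forall k f g, V0 f -> V0 g -> V0 (k *: f + g).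
Hypothesis iota_lin : forall k f g, V0 f -> V0 g ->
  iota (k *: f + g) = k *: iota f + iota g.
Hypothesis iota_dense : closure (iota @` V0) = [set: H].

Definition approximates (u : nat -> XT -> R) (x : H) :=
  (forall n, V0 (u n)) /\ iota (u n) @[n --> \oo] --> x.

Lemma approximates_exists x : exists u, approximates u x.
Proof.
have uP n : {f | V0 f /\ `|x - iota f| < n.+1%:R^-1}.
  apply: cid; have : closure (iota @` V0) x by rewrite iota_dense.
  have n0 : 0 < n.+1%:R^-1 :> R by rewrite invr_gt0.
  move=> /(_ _ (nbhsx_ballx x _ n0)) [_ [[f Vf <-]]].
  by rewrite -ball_normE/= => fx; exists f.
exists (fun n => sval (uP n)); split; first by move=> n; case: (svalP (uP n)).
apply/cvgrPdist_lt => e e0; near=> n.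
apply: (lt_trans (svalP (uP n)).2).
by near: n; exact: (near_infty_natSinv_lt (PosNum e0)).
Unshelve. all: by end_near.
Qed.

Lemma approximates_lin k u v x y : approximates u x -> approximates v y ->
  approximates (fun n => k *: u n + v n) (k *: x + y).
Proof.
move=> [uV ux] [vV vy]; split; first by move=> n; exact: V0_lin.
have E n : iota (k *: u n + v n) = k *: iota (u n) + iota (v n) by exact: iota_lin.
by rewrite (eq_cvg _ _ E); apply: cvgD => //; exact: cvgZr.
Qed.

Context {dY} {Y : measurableType dY}.
Variables (mu : {measure set Y -> \bar R}) (D : set Y).
Hypothesis mD : measurable D.
Variables (op : (XT -> R) -> Y -> R) (C : R).
Hypothesis C0 : 0 <= C.
Hypothesis op_lin : forall k f g, V0 f -> V0 g ->
  {in D, op (k *: f + g) =1 k *: op f + op g}.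
Hypothesis op_L2 : forall f, V0 f -> L2 mu D (op f).
Hypothesis op_bounded : forall f, V0 f ->
  L2_dot mu D (op f) (op f) <= C * `|iota f| ^+ 2.
Local Notation E := (extend Omega T iota mu D op).
Local Notation "<< f , g >>" := (L2_dot mu D f g).

Let op_normB f g : V0 f -> V0 g ->
  <<op f - op g, op f - op g>> <= C * `|iota f - iota g| ^+ 2.
Proof.
move=> Vf Vg; have := op_bounded (V0_lin (-1) Vg Vf).
rewrite iota_lin// [-1 *: iota g]scaleN1r [- iota g + _]addrC; apply: le_trans.
rewrite le_eqVlt; apply/orP; left; apply/eqP; apply: eq_Rintegral => y yD.
by rewrite op_lin// scaleN1r [- _ + _]addrC.
Qed.

(** Images of an approximating sequence are Cauchy in L^2, so they have a limit;
    boundedness makes it the same for all sequences approximating [x], which is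
    the property that [extend] selects a function for. *)
Lemma extendP x : L2 mu D (E x) /\
  forall u, approximates u x -> cvg_L2 mu D (fun n => op (u n)) (E x).
Proof.
have [u0 [u0V u0x]] := approximates_exists x.
have u0L n : L2 mu D (op (u0 n)) := op_L2 (u0V n).
have [g gL u0g] : exists2 g, L2 mu D g & cvg_L2 mu D (fun n => op (u0 n)) g.
  apply: (L2_complete mD u0L) => e e0.
  have d0 : 0 < e / (C + 1) by rewrite divr_gt0// ltr_wpDl.
  have d1 : 0 < Num.min 1 (e / (C + 1)) by rewrite lt_min ltr01.
  have /cvg_cauchy/cauchy_ballP/(_ _ d1) : cvgn (iota \o u0) by apply/cvg_ex; exists x.
  rewrite near_simpl => -[[A B] [[m1 _ A1] [m2 _ B2]] AB].
  exists (maxn m1 m2) => n m; rewrite !geq_max => /andP[n1 _] /andP[_ m3].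
  apply: (le_trans (op_normB (u0V _) (u0V _))).
  have /= := AB (n, m) (conj (A1 _ n1) (B2 _ m3)).
  rewrite -ball_normE/= lt_min; set z := `|_| => /andP[z1 z2].
  have z0 : 0 <= z := normr_ge0 _.
  have zz : z ^+ 2 <= e / (C + 1).
    by apply: le_trans (ltW z2); rewrite expr2 ler_piMl// ltW.
  apply: (@le_trans _ _ ((C + 1) * (e / (C + 1)))).
    by apply: ler_pM => //; [exact: sqr_ge0|rewrite lerDl].
  by rewrite mulrC divfK// gt_eqF// ltr_wpDl.
have [gL' gP] : [set h | L2 mu D h /\ forall u : nat -> XT -> R,
    (forall n, V0 (u n)) -> iota (u n) @[n --> \oo] --> x ->
    cvg_L2 mu D (fun n => op (u n)) h] (E x); last first.
  by split=> // u [uV ux]; exact: gP.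
apply: getPex; exists g; split=> // u uV ux.
have uL n : L2 mu D (op (u n)) := op_L2 (uV n).
apply/(cvg_L2P mD uL gL); move/(cvg_L2P mD u0L gL) : u0g => u0g.
apply: (@squeeze_cvgr _ _ _ _ (cst 0) (fun n =>
    Num.sqrt C * `|iota (u n) - iota (u0 n)| + L2_norm mu D (op (u0 n) - g))).
- apply: nearW => n; rewrite L2_norm_ge0/=.
  apply: (le_trans (L2_normB_le mD (uL n) (u0L n) gL)); rewrite lerD2r.
  rewrite -ler_sqr ?nnegrE ?L2_norm_ge0 ?mulr_ge0 ?sqrtr_ge0//.
  by rewrite L2_norm_sqr exprMn sqr_sqrtr// op_normB.
- exact: cvg_cst.
- rewrite -[X in _ --> X](_ : Num.sqrt C * `|x - x| + 0 = 0); last first.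
    by rewrite subrr normr0 mulr0 addr0.
  by apply: cvgD => //; apply: cvgMr; apply: cvg_norm; exact: cvgB.
Qed.

Lemma extend_L2 x : L2 mu D (E x).
Proof. by case: (extendP x). Qed.

Lemma extend_dot_cvg u v x y : approximates u x -> approximates v y ->
  <<op (u n), op (v n)>> @[n --> \oo] --> <<E x, E y>>.
Proof.
move=> ux vy; have uV := ux.1; have vV := vy.1.
apply: (cvg_L2_dot mD).
all: try by move=> n; exact: op_L2.
all: try exact: extend_L2.
- exact: (extendP x).2.
- exact: (extendP y).2.
Qed.

Lemma extend_dotl_cvg u x h : approximates u x -> L2 mu D h ->
  <<op (u n), h>> @[n --> \oo] --> <<E x, h>>.
Proof.
move=> ux hL; have uV := ux.1.
apply: (cvg_L2_dot mD (v := fun=> h)) => //.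
- by move=> n; exact: op_L2.
- exact: extend_L2.
- exact: (extendP x).2.
apply/(cvg_L2P mD) => //.
rewrite (_ : (fun=> _) = cst 0); first exact: cvg_cst.
apply/funext => n /=; rewrite subrr /L2_norm /L2_dot /Rintegral.
by under eq_integral do rewrite mulr0; rewrite integral0 sqrtr0.
Qed.

(** [E (k *: x + y)] and [k *: E x + E y] are values of an arbitrary choice and
    may differ on a null set; inner products, being limits along approximating
    sequences, do not see the difference. *)
Lemma extend_dot_lin k x y h : L2 mu D h ->
  <<E (k *: x + y), h>> = k * <<E x, h>> + <<E y, h>>.
Proof.
move=> hL; have [u ux] := approximates_exists x.
have [v vy] := approximates_exists y.
have c1 := extend_dotl_cvg (approximates_lin k ux vy) hL.
have c2 : k * <<op (u n), h>> + <<op (v n), h>> @[n --> \oo] -->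
    k * <<E x, h>> + <<E y, h>>.
  by apply: cvgD; [apply: cvgMr|]; exact: extend_dotl_cvg.
have EE n : <<op (k *: u n + v n), h>> = k * <<op (u n), h>> + <<op (v n), h>>.
  have [uV vV] := (ux.1 n, vy.1 n).
  rewrite -(L2_dot_lin mD)//; [|exact: op_L2|exact: op_L2].
  by apply: eq_Rintegral => z zD; rewrite op_lin.
rewrite (eq_cvg _ _ EE) in c1.
exact: (cvg_unique (@Rhausdorff R) c1 c2).
Qed.

End extension.

(** * Continuous functions on a bounded cylinder *)

Section open_measurable.
Context {R : realType} {N : nat}.
Local Notation XT := ('rV[R]_N * R)%type.
Local Notation MX := 'rV[measurableTypeR R]_N.
Local Notation MXT := ('rV[measurableTypeR R]_N * measurableTypeR R)%type.

Let rational_box (p : 'rV[rat]_N * rat * nat) : set MXT :=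
  [set z : XT | (forall i, `|ratr (p.1.1 0 i) - z.1 0 i| < p.2.+1%:R^-1) /\
           `|ratr p.1.2 - z.2| < p.2.+1%:R^-1].

Let measurable_distance_lt (a e : R) :
  measurable ([set x | `|a - x| < e] : set (measurableTypeR R)).
Proof. by have := measurable_ball a e; rewrite -ball_normE. Qed.

Let rational_box_measurable p : measurable (rational_box p).
Proof.
rewrite (_ : rational_box p =
   \bigcap_(i in [set: 'I_N]) ((fun z : MXT => z.1 0 i : measurableTypeR R) @^-1`
      [set x | `|ratr (p.1.1 0 i) - x| < p.2.+1%:R^-1]) `&`
   (snd @^-1` [set x | `|ratr p.1.2 - x| < p.2.+1%:R^-1])); last first.
  apply/seteqP; split => z [h1 h2]; split => //= i.
  - by move=> _; exact: h1.
  - exact: (h1 i).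
apply: measurableI.
  apply: fin_bigcap_measurable => // i _; rewrite -[X in measurable X]setTI.
  exact: (measurableT_comp (@measurable_coord_rV _ (measurableTypeR R) N i)
    (@measurable_fst _ _ MX (measurableTypeR R)) measurableT
    (measurable_distance_lt _ _)).
rewrite -[X in measurable X]setTI.
exact: (@measurable_snd _ _ MX (measurableTypeR R) measurableT _
  (measurable_distance_lt _ _)).
Qed.

Lemma rational_approximation (a e : R) : 0 < e -> exists q : rat, `|ratr q - a| < e.
Proof.
move=> e0; have [q] := @rat_in_itvoo R (a - e) (a + e) ltac:(lra).
rewrite in_itv/= => /andP[q1 q2]; exists q; rewrite ltr_norml; lra.
Qed.

(** The product sigma-algebra contains the open sets because the topology has
    a countable base of boxes with rational data. *)
Lemma open_measurable_xt (O : set XT) : open O -> measurable (O : set MXT).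
Proof.
move=> oO.
have -> : O = \bigcup_p (if `[< rational_box p `<=` O >] then rational_box p else set0).
  apply/seteqP; split => [z Oz|z [p _]]; last by case: asboolP => // + h; exact.
  have /nbhs_ballP[e /= e0 eO] : nbhs z O by exact: open_nbhs_nbhs.
  have [k ke] : exists k, k.+1%:R^-1 < e / 2.
    have e2 : 0 < e / 2 by rewrite divr_gt0.
    have [k _ /(_ k (leqnn k))] := near_infty_natSinv_lt (PosNum e2).
    by exists k.
  have k0 : 0 < k.+1%:R^-1 :> R by rewrite invr_gt0.
  have [t zt] := rational_approximation z.2 k0.
  have /choice[q zq] : forall i, exists q : rat, `|ratr q - z.1 0 i| < k.+1%:R^-1.
    by move=> i; exact: rational_approximation.
  have boxz : rational_box (\row_i q i, t, k) z.
    by split => //= i; rewrite mxE.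
  exists (\row_i q i, t, k) => //; case: asboolP => // -[] y [/= y1 y2].
  apply: eO; rewrite /ball/= /prod_ball.
  have tri (a b c : R) : `|a - b| < k.+1%:R^-1 -> `|a - c| < k.+1%:R^-1 -> `|b - c| < e.
    move=> ab ac; rewrite -(subrKA a) (le_lt_trans (ler_normD _ _))//.
    by rewrite (distrC b); move: (k.+1%:R^-1) ke ab ac => s; lra.
  split; last by rewrite -ball_normE; exact: tri y2.
  split => // i j; rewrite ord1 -ball_normE/=.
  by have := y1 j; rewrite mxE; exact: tri.
apply: countable_bigcupT_measurable; first exact: countableP.
move=> p; case: asboolP => _; [exact: rational_box_measurable|exact: measurable0].
Qed.

Lemma open_measurable_x (O : set 'rV[R]_N) : open O -> measurable (O : set MX).
Proof.
move=> oO; have oO1 : open ((fst : XT -> 'rV[R]_N) @^-1` O).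
  by apply: open_comp => // z _; exact: cvg_fst.
have := measurable_ysection (0 : measurableTypeR R) (open_measurable_xt oO1).
congr measurable; apply/seteqP; split => x /=; rewrite /ysection/= inE//.
Qed.

End open_measurable.

(** The map [e] is meant to be the identity of a carrier that has a topology as
    [V] and an independently declared sigma-algebra as [Y]. *)
Lemma open_continuous_measurable_fun {R : realType} (V : topologicalType)
    dY (Y : measurableType dY) (e : Y -> V) (D : set V) (f : V -> R) :
  (forall O, open O -> measurable (e @^-1` O)) -> open D ->
  {in D, continuous f} -> measurable_fun (e @^-1` D) (f \o e).
Proof.
move=> oY oD cf mD; apply: (measurability _ (RGenOpens.measurableE R)) => //.
move=> _ [_ [a [b ->] <-]].
have -> : e @^-1` D `&` (f \o e) @^-1` `]a, b[%classic =
    e @^-1` (D `&` f @^-1` `]a, b[%classic) by [].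
apply: oY; rewrite openE => x [Dx fx].
apply: filterI; first exact: open_nbhs_nbhs.
by apply: (cf x (mem_set Dx)); apply: open_nbhs_nbhs; split => //; exact: interval_open.
Qed.


Section bounded_measurable.
Context {dY} {Y : measurableType dY} {R : realType}.
Implicit Types (D : set Y) (f g : Y -> R).

Definition bounded_measurable D f :=
  measurable_fun D f /\ exists M, forall x, D x -> `|f x| <= M.

Lemma bounded_measurable_eq D f g : {in D, f =1 g} ->
  bounded_measurable D f -> bounded_measurable D g.
Proof.
move=> fg [mf [M fM]]; split; first exact: eq_measurable_fun mf.
by exists M => x Dx; rewrite -fg ?inE//; exact: fM.
Qed.

Lemma bounded_measurableS D E f : measurable D -> E `<=` D ->
  bounded_measurable D f -> bounded_measurable E f.
Proof.
move=> mD ED [mf [M fM]]; split; first exact: measurable_funS mf.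
by exists M => x /ED; exact: fM.
Qed.

Lemma bounded_measurable_cst D (k : R) : bounded_measurable D (fun=> k).
Proof. by split; [exact: measurable_cst|exists `|k|]. Qed.

Lemma bounded_measurableD D f g : bounded_measurable D f ->
  bounded_measurable D g -> bounded_measurable D (fun x => f x + g x).
Proof.
move=> [mf [M fM]] [mg [M' gM]]; split; first exact: measurable_funD.
exists (M + M') => x Dx.
by apply: (le_trans (ler_normD _ _)); apply: lerD; [exact: fM|exact: gM].
Qed.

Lemma bounded_measurableM D f g : bounded_measurable D f ->
  bounded_measurable D g -> bounded_measurable D (fun x => f x * g x).
Proof.
move=> [mf [M fM]] [mg [M' gM]]; split; first exact: measurable_funM.
exists (M * M') => x Dx; rewrite normrM.
by apply: ler_pM => //; [exact: fM|exact: gM].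
Qed.

Lemma bounded_measurableN D f : bounded_measurable D f ->
  bounded_measurable D (fun x => - f x).
Proof.
move=> [mf [M fM]]; split; first exact: measurable_funN.
by exists M => x Dx; rewrite normrN; exact: fM.
Qed.

Lemma bounded_measurable_sum D (I : finType) (f : I -> Y -> R) :
  (forall i, bounded_measurable D (f i)) ->
  bounded_measurable D (fun x => \sum_i f i x).
Proof.
move=> fb; rewrite /index_enum; elim: (Finite.enum _) => [|i s IH].
  apply: (bounded_measurable_eq (f := fun=> 0)); last exact: bounded_measurable_cst.
  by move=> x _; rewrite big_nil.
apply: (bounded_measurable_eq (f := fun x => f i x + \sum_(j <- s) f j x)).
  by move=> x _; rewrite big_cons.
exact: bounded_measurableD.
Qed.

End bounded_measurable.

(** [C(closure U)], as far as the values on [U] are concerned. *)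
Definition continuous_up_to_closure {R : realType} {V : topologicalType}
    (U : set V) (f : V -> R) :=
  exists g : V -> R, {within closure U, continuous g} /\ {in U, f =1 g}.

Lemma continuous_up_to_closure_open {R : realType} {V : topologicalType}
    (U : set V) (f : V -> R) : open U ->
  continuous_up_to_closure U f -> {in U, continuous f}.
Proof.
move=> oU [g [cg fg]] x xU.
have : {within U, continuous g}.
  by apply: continuous_subspaceW cg; exact: subset_closure.
rewrite continuous_open_subspace// => /(_ x xU) gx.
have Ux : nbhs x U by apply: open_nbhs_nbhs; split => //; exact: set_mem.
rewrite /continuous_at fg//; apply: cvg_trans gx; apply: near_eq_cvg.
by apply: filterS Ux => y Uy; rewrite fg// inE.
Qed.

Lemma continuous_up_to_closure_bounded {R : realType} {V : topologicalType}
    (U : set V) (f : V -> R) : compact (closure U) ->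
  continuous_up_to_closure U f -> exists M, forall x, U x -> `|f x| <= M.
Proof.
move=> cU [g [cg fg]].
have [M [_ gM]] := compact_bounded (continuous_compact cg cU).
exists (M + 1) => x Ux; rewrite fg ?inE//; apply: gM; first by rewrite ltrDl.
by exists x => //; exact: subset_closure.
Qed.

Lemma continuous_up_to_closure_bounded_measurable {R : realType}
    (V : topologicalType) dY (Y : measurableType dY) (e : Y -> V)
    (D : set V) (f : V -> R) :
  (forall O, open O -> measurable (e @^-1` O)) -> open D ->
  compact (closure D) -> continuous_up_to_closure D f ->
  bounded_measurable (e @^-1` D) (f \o e).
Proof.
move=> oY oD cD fD; split.
  by apply: open_continuous_measurable_fun => //; exact: continuous_up_to_closure_open.
by have [M fM] := continuous_up_to_closure_bounded cD fD; exists M => x; exact: fM.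
Qed.

Lemma lebesgue_rV_bounded {R : realType} N (A : set 'rV[R]_N) : bounded_set A ->
  measurable (A : set 'rV[measurableTypeR R]_N) -> (lebesgue_rV R N A < +oo)%E.
Proof.
move=> [M [_ AM]] mA.
pose I (i : 'I_N) : set (measurableTypeR R) := `[- (M + 1), M + 1]%classic.
have mI i : measurable (I i) by exact: measurable_itv.
pose B := [set v : 'rV[measurableTypeR R]_N | forall i, I i (v ord0 i)].
have mB : measurable B.
  rewrite (_ : B = \bigcap_(i in [set: 'I_N])
      ((fun v : 'rV[measurableTypeR R]_N => v ord0 i) @^-1` I i)).
    apply: fin_bigcap_measurable => // i _; rewrite -[X in measurable X]setTI.
    exact: measurable_coord_rV.
  by apply/seteqP; split => v /= Bv i; [move=> _|]; exact: Bv.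
have AB : A `<=` B.
  move=> v Av i; rewrite /I /= in_itv/= -ler_norml.
  have vM : `|v| <= M + 1 by apply: AM => //; rewrite ltrDl.
  apply: le_trans vM; rewrite {2}/Num.norm/= mx_normrE.
  by apply/bigmax_geP; right; exists (ord0, i).
apply: (@le_lt_trans _ _ (lebesgue_rV R N B)); first by apply: le_measure => //; rewrite inE.
have /andP[//] : (0 <= lebesgue_rV R N B < +oo)%E.
rewrite /lebesgue_rV power_measure_box//.
apply: (@big_ind _ (fun x => (0 <= x < +oo)%E)) => [|x y /andP[x0 xy] /andP[y0 yy]|i _].
- by rewrite lee01 ltry.
- by rewrite mule_ge0// lte_mul_pinfty// ge0_fin_numE.
- rewrite measure_ge0 /=.
  apply: (@le_lt_trans _ _ (lebesgue_measure `[- (M + 1), M + 1]%classic)) => //.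
  by rewrite lebesgue_measure_itv/=; case: ifP => _; rewrite ?ltry.
Qed.

Section cylinder.
Context {R : realType} {N : nat}.
Local Notation MXT := ('rV[measurableTypeR R]_N * measurableTypeR R)%type.
Variables (A : set 'rV[R]_N) (T : R).
Hypotheses (oA : open A) (bA : bounded_set A).

Lemma open_cylinder : open (cylinder A T).
Proof.
rewrite openE => -[x t] [Ax Tt].
exists (A, `]0, T[%classic); last by [].
split; apply: open_nbhs_nbhs; split => //; exact: interval_open.
Qed.

Lemma cylinder_measurable : measurable (cylinder A T : set MXT).
Proof. exact: open_measurable_xt open_cylinder. Qed.

Lemma cylinder_finite_measure : (lebesgue_xt R N (cylinder A T) < +oo)%E.
Proof.
have -> : lebesgue_xt R N (cylinder A T) =
    (lebesgue_rV R N A * @lebesgue_measure R `]0%R, T[%classic)%E.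
  apply: product_measure1E; first exact: open_measurable_x.
  exact: measurable_itv.
rewrite lte_mul_pinfty//.
- by rewrite ge0_fin_numE// lebesgue_rV_bounded//; exact: open_measurable_x.
- apply: (@le_lt_trans _ _ (lebesgue_measure `]0, T[%classic)) => //.
  by rewrite lebesgue_measure_itv/=; case: ifP => _; rewrite ?ltry.
Qed.

Lemma closure_bounded_compact : compact (closure A).
Proof.
apply: bounded_closed_compact; last exact: closed_closure.
have [M [Mr AM]] := bA; exists M; split => // s Ms x cx.
have cB : closed [set y : 'rV[R]_N | `|y| <= s].
  rewrite (_ : [set y | _] = Num.norm @^-1` [set u | u <= s])//.
  by apply: closed_comp => [y _|]; [exact: norm_continuous|exact: closed_le].
suff : [set y : 'rV[R]_N | `|y| <= s] x by [].
by move/closure_id : cB => ->; apply: closureS cx => y Ay; exact: AM.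
Qed.

Lemma closure_cylinder_compact : compact (closure (cylinder A T)).
Proof.
apply: (@subclosed_compact _ _ (closure A `*` `[0, T]%classic)).
- exact: closed_closure.
- by apply: compact_setX; [exact: closure_bounded_compact|exact: segment_compact].
- move=> [x t] cxt; split => /=.
    move=> B Bx; have [|[y s] [[Ay _] [By _]]] := cxt (B `*` setT).
      by exists (B, setT) => //; split => //; exact: filterT.
    by exists y.
  suff : closure `[0, T]%classic t.
    have cI : closed (`[0, T]%classic : set R) by exact: interval_closed.
    by rewrite -((closure_id _).1 cI).
  move=> B Bt; have [|[y s] [[_ Ts] [_ Bs]]] := cxt (setT `*` B).
    by exists (setT, B) => //; split => //; exact: filterT.
  by exists s; split=> //; move: Ts; rewrite /= !in_itv/= => /andP[/ltW -> /ltW ->].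
Qed.

End cylinder.

(** * Smooth functions vanishing on the lateral boundary *)

Section Ck_linear.
Context {R : realType} {V : normedModType R}.
Variable U : set V.
Hypothesis oU : open U.
Implicit Types f g : V -> R.

Let near_U x : x \in U -> \forall y \near x, U y.
Proof. by move=> xU; apply: open_nbhs_nbhs; split => //; exact: set_mem. Qed.

Lemma eq_on_derive f g v : {in U, f =1 g} -> {in U, 'D_v f =1 'D_v g}.
Proof.
move=> fg x xU; apply: near_eq_derive; apply: filterS (near_U xU) => y Uy.
by rewrite fg// inE.
Qed.

Lemma eq_on_derivable f g x v : {in U, f =1 g} -> x \in U ->
  derivable f x v -> derivable g x v.
Proof.
move=> fg xU; apply: near_eq_derivable; apply: filterS (near_U xU) => y Uy.
by rewrite fg// inE.
Qed.

(** Derivatives at points of an open set depend only on the values in it, so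
    formal identities valid on [U] propagate through the recursive definition. *)
Lemma Ck_up_to_eq k f g : {in U, f =1 g} -> Ck_up_to k U f -> Ck_up_to k U g.
Proof.
elim: k f g => [|k IH] f g fg /= [[h [ch fh]] fd].
  by split => //; exists h; split => // x xU; rewrite -fg// fh.
split; first by exists h; split => // x xU; rewrite -fg// fh.
move=> v; have [fv Dv] := fd v; split; last exact: (IH _ _ (eq_on_derive v fg)).
by move=> x xU; exact: (eq_on_derivable fg xU (fv x xU)).
Qed.

Lemma within_continuous_lin (A : set V) a f g : {within A, continuous f} ->
  {within A, continuous g} -> {within A, continuous (a *: f + g)}.
Proof.
by move=> cf cg x; apply: cvgD; [apply: cvgZr; exact: cf|exact: cg].
Qed.

Lemma derive_lin a f g x v : derivable f x v -> derivable g x v ->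
  'D_v (a *: f + g) x = a * 'D_v f x + 'D_v g x.
Proof.
move=> df dg; have daf : derivable (a *: f) x v by exact: derivableZ.
by rewrite deriveD//; congr (_ + _); exact: deriveZ.
Qed.

Lemma derivable_lin a f g x v : derivable f x v -> derivable g x v ->
  derivable (a *: f + g) x v.
Proof. by move=> df dg; apply: derivableD => //; exact: derivableZ. Qed.

Lemma Ck_up_to_lin k a f g :
  Ck_up_to k U f -> Ck_up_to k U g -> Ck_up_to k U (a *: f + g).
Proof.
elim: k f g => [|k IH] f g /= [[h [ch fh]] fd] [[h' [ch' gh]] gd].
all: have lin0 : exists h : V -> R, {within closure U, continuous h} /\
    {in U, a *: f + g =1 h}
  by exists (a *: h + h'); split; [exact: within_continuous_lin|
    move=> x xU; rewrite !fctE fh// gh].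
  by [].
split=> // v; have [fv Df] := fd v; have [gv Dg] := gd v; split.
  by move=> x xU; apply: derivable_lin; [exact: fv|exact: gv].
apply: Ck_up_to_eq (IH _ _ Df Dg) => x xU.
by rewrite derive_lin//; [exact: fv|exact: gv].
Qed.

End Ck_linear.

Lemma Phi0_lin {R : realType} N (Omega : set 'rV[R]_N) T k f g : open Omega ->
  Phi0 Omega T f -> Phi0 Omega T g -> Phi0 Omega T (k *: f + g).
Proof.
move=> oO [[cf Cf] f0] [[cg Cg] g0]; split.
  split; first exact: within_continuous_lin.
  by apply: Ck_up_to_lin => //; exact: open_cylinder.
by move=> z zS; rewrite !fctE f0// g0// scaler0 addr0.
Qed.

(** * The operators of the control problem *)

Lemma closure_itvoo {R : realType} (b t : R) : 0 < b -> 0 <= t <= b ->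
  closure (`]0, b[%classic : set R) t.
Proof.
move=> b0 /andP[t0 tb] B /nbhs_ballP[e /= e0 eB].
(* s lies on the way from t to the midpoint of the interval. *)
pose k := Num.min 2^-1 (e / b); pose s := t + k * (b / 2 - t).
have k0 : 0 < k by rewrite lt_min divr_gt0// andbT; lra.
have k2 : k <= 2^-1 by rewrite ge_min lexx.
have ke : k * b <= e by rewrite -ler_pdivlMr// ge_min lexx orbT.
exists s; split; first by rewrite /= in_itv/= /s; apply/andP; split; nra.
apply: eB; rewrite -ball_normE/= /s opprD addNKr normrN ltr_norml.
by apply/andP; split; nra.
Qed.

Section operators.
Context {R : realType} {N : nat}.
Local Notation XT := ('rV[R]_N * R)%type.
Local Notation MXT := ('rV[measurableTypeR R]_N * measurableTypeR R)%type.
Local Notation mux := (lebesgue_rV R N).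
Local Notation muxt := (lebesgue_xt R N).
Variables (Omega omega : set 'rV[R]_N) (T : R).
Hypotheses (oO : open Omega) (bO : bounded_set Omega).
Hypotheses (oomega : open omega) (oO_sub : omega `<=` Omega) (T0 : 0 < T).
Variables (c : 'rV[R]_N -> 'M[R]_N) (d : XT -> R).
Hypothesis c_C1 : forall i j, Ck_closure 1 Omega (fun x => c x i j).
Hypothesis d_Linfty : Lp_on muxt (cylinder Omega T) +oo%E d.
Local Notation Q := (cylinder Omega T).
Local Notation q := (cylinder omega T).
Local Notation V0 := (Phi0 Omega T).
Implicit Types f g : XT -> R.

Let e_ (i : 'I_N) : XT := (delta_mx 0 i, 0).

Let cucQ_bounded_measurable f :
  continuous_up_to_closure Q f -> bounded_measurable (Q : set MXT) f.
Proof.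
apply: (@continuous_up_to_closure_bounded_measurable _ XT _ MXT id).
- exact: open_measurable_xt.
- exact: open_cylinder.
- exact: closure_cylinder_compact.
Qed.

Let cucO_bounded_measurable (h : 'rV[R]_N -> R) : continuous_up_to_closure Omega h ->
  bounded_measurable (Omega : set 'rV[measurableTypeR R]_N) h.
Proof.
apply: (@continuous_up_to_closure_bounded_measurable _ _ _ 'rV[measurableTypeR R]_N id).
- exact: open_measurable_x.
- by [].
- exact: closure_bounded_compact.
Qed.

Let space_bounded_measurable (h : 'rV[R]_N -> R) : continuous_up_to_closure Omega h ->
  bounded_measurable (Q : set MXT) (fun z => h z.1).
Proof.
move=> /cucO_bounded_measurable[mh [M hM]]; split; last first.
  by exists M => z [zO _]; exact: hM.
apply: (@measurable_comp _ _ _ MXT 'rV[measurableTypeR R]_N _ Omega h Q fst).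
- exact: open_measurable_x.
- by move=> _ [z [zO _] <-].
- exact: mh.
- by apply: measurable_funTS; exact: measurable_fst.
Qed.

Lemma derive_fst (h : 'rV[R]_N -> R) (z v : XT) :
  'D_v (fun w : XT => h w.1) z = 'D_v.1 h z.1.
Proof. by []. Qed.

Lemma derivable_fst (h : 'rV[R]_N -> R) (z v : XT) :
  derivable h z.1 v.1 -> derivable (fun w : XT => h w.1) z v.
Proof. by []. Qed.

Definition flux (i : 'I_N) f : XT -> R := fun w => \sum_j c w.1 i j * d_x j f w.

Lemma Lstar_flux f z :
  Lstar c d f z = - d_t f z - \sum_i d_x i (flux i f) z + d z * f z.
Proof. by []. Qed.

Let Q_open : open Q. Proof. exact: open_cylinder. Qed.

(** Product rule. It shows that the flux is differentiable, as linearity of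
    [Lstar] requires, and that its divergence is bounded and measurable. *)
Lemma flux_is_derive i f z : V0 f -> z \in Q ->
  is_derive z (e_ i) (flux i f)
    (\sum_j (c z.1 i j *: d_x i (d_x j f) z +
             d_x j f z *: 'D_(delta_mx 0 i) (fun x => c x i j) z.1)).
Proof.
move=> [[_ [_ Df]] _] zQ; have zO : z.1 \in Omega by move/set_mem: zQ => [? _]; rewrite inE.
have -> : flux i f = \sum_j ((fun w : XT => c w.1 i j) * d_x j f).
  by apply/funext => w; rewrite fct_sumE.
apply: is_derive_sum => j; apply: is_deriveM; apply: DeriveDef.
- have [_ [_ Dc]] := c_C1 i j.
  exact: (@derivable_fst (fun x => c x i j) z (e_ i) ((Dc (delta_mx 0 i)).1 _ zO)).
- exact: (@derive_fst (fun x => c x i j)).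
- have [_ [_ Dj]] := Df (e_ j).
  exact: (Dj (e_ i)).1.
- by [].
Qed.

Lemma Lstar_lin k f g : V0 f -> V0 g ->
  {in Q, Lstar c d (k *: f + g) =1 k *: Lstar c d f + Lstar c d g}.
Proof.
move=> Vf Vg z zQ; have [[_ [_ Df]] _] := Vf; have [[_ [_ Dg]] _] := Vg.
have dlin v : {in Q, 'D_v (k *: f + g) =1 k *: 'D_v f + 'D_v g}.
  by move=> w wQ; rewrite derive_lin//; [exact: (Df v).1|exact: (Dg v).1].
have Fl i : {in Q, flux i (k *: f + g) =1 k *: flux i f + flux i g}.
  move=> w wQ; rewrite /flux !fctE scaler_sumr -big_split/=; apply: eq_bigr => j _.
  by rewrite /d_x dlin// !fctE /GRing.scale/=; ring.
have dFl i : d_x i (flux i (k *: f + g)) z = k * d_x i (flux i f) z + d_x i (flux i g) z.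
  rewrite /d_x (eq_on_derive Q_open _ (Fl i))//.
  have [df _] := flux_is_derive i Vf zQ; have [dg _] := flux_is_derive i Vg zQ.
  exact: (derive_lin k df dg).
have dt : d_t (k *: f + g) z = k * d_t f z + d_t g z by exact: dlin.
have dsum : \sum_i d_x i (flux i (k *: f + g)) z =
    k * \sum_i d_x i (flux i f) z + \sum_i d_x i (flux i g) z.
  by rewrite mulr_sumr -big_split/=; apply: eq_bigr => i _; exact: dFl.
have fgE : (k *: f + g) z = k * f z + g z by [].
have -> : (k *: Lstar c d f + Lstar c d g) z = k * Lstar c d f z + Lstar c d g z.
  by [].
apply: (eq_trans (Lstar_flux (k *: f + g) z)).
rewrite dt dsum fgE (Lstar_flux f) (Lstar_flux g).
have alg (t1 t2 s1 s2 f1 f2 e : R) :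
    - (k * t1 + t2) - (k * s1 + s2) + e * (k * f1 + f2) =
    k * (- t1 - s1 + e * f1) + (- t2 - s2 + e * f2) by ring.
exact: alg.
Qed.

Lemma Lstar_L2 f : V0 f -> L2 muxt Q (Lstar c d f).
Proof.
move=> Vf; have [[_ [fc Df]] _] := Vf.
have mQ : measurable (Q : set MXT) by exact: cylinder_measurable.
have Qoo : (muxt Q < +oo)%E by exact: cylinder_finite_measure.
pose h z := - d_t f z - \sum_i \sum_j (c z.1 i j * d_x i (d_x j f) z +
             d_x j f z * 'D_(delta_mx 0 i) (fun x => c x i j) z.1).
have hB : bounded_measurable (Q : set MXT) h.
  apply: bounded_measurableD; apply: bounded_measurableN.
    exact: (cucQ_bounded_measurable (Df (0, 1)).2.1).
  apply: bounded_measurable_sum => i; apply: bounded_measurable_sum => j.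
  have [_ [dj Dj]] := Df (e_ j); have [_ [cc Dc]] := c_C1 i j.
  apply: bounded_measurableD; apply: bounded_measurableM.
  - exact: (space_bounded_measurable cc).
  - exact: (cucQ_bounded_measurable (Dj (e_ i)).2.1).
  - exact: (cucQ_bounded_measurable dj).
  - exact: (space_bounded_measurable (Dc (delta_mx 0 i)).2.1).
have hL : L2 muxt Q h.
  have [mh [M hM]] := hB; apply: (L2_ess_bounded mQ (M := M)) => //.
  by apply: aeW => z; exact: hM.
have dfL : L2 muxt Q (fun z => d z * f z).
  have [md [M dM]] := Linfty_ess_bounded mQ d_Linfty.
  have [mf [M' fM']] := cucQ_bounded_measurable fc.
  apply: (L2_ess_bounded mQ (M := M * M')) => //; first exact: measurable_funM.
  apply: filterS dM => z dz zQ; rewrite normrM.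
  by apply: ler_pM => //; [exact: dz|exact: fM'].
apply: L2_eq (L2_lin 1 hL dfL) => z zQ; rewrite !fctE scale1r /Lstar /h.
congr (- _ - _ + _); apply: eq_bigr => i _.
by have [_ <-] := flux_is_derive i Vf zQ.
Qed.

(** For [t = 0] or [t = T] the points [(x, t)] lie outside [Q]; continuity of the
    trace comes from continuity on the closure of [Q]. *)
Lemma trace_L2 f t : 0 <= t <= T -> V0 f -> L2 mux Omega (fun x => f (x, t)).
Proof.
move=> tT [[cf _] _].
have clQ x : closure Omega x -> closure Q (x, t).
  move=> Ox B [[B1 B2] [/= B1x B2t] B12].
  have [y [Oy B1y]] := Ox _ B1x.
  have [s [Ts B2s]] := closure_itvoo T0 tT B2t.
  by exists (y, s); split=> //; exact: (B12 (y, s)).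
have : bounded_measurable (Omega : set 'rV[measurableTypeR R]_N) (fun x => f (x, t)).
  apply: cucO_bounded_measurable; exists (fun x => f (x, t)); split => //.
  apply/subspace_continuousP => x Ox.
  have /subspace_continuousP/(_ _ (clQ _ Ox)) := cf.
  apply: cvg_comp => B [[B1 B2] [/= B1x B2t] B12].
  apply: filterS B1x => y B1y Oy; apply: (B12 (y, t)); last exact: clQ.
  by split => //; exact: nbhs_singleton.
move=> [mf [M fM]].
apply: (@L2_ess_bounded _ _ _ mux _ _ _ M) => //.
- exact: open_measurable_x.
- by apply: lebesgue_rV_bounded => //; exact: open_measurable_x.
- by apply: aeW => x; exact: fM.
Qed.

Variables (rho_star : R) (rho0 : XT -> R).
Hypothesis rho_star0 : 0 < rho_star.
Hypothesis rho0_weight : weight_class Omega T rho_star rho0.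

Lemma weight_gt0 z : Q z -> 0 < rho0 z.
Proof.
have [_ h _] := rho0_weight; move=> Qz.
by apply: lt_le_trans (h z (mem_set Qz)).
Qed.

Lemma subcylinder : q `<=` Q.
Proof. by move=> z [/oO_sub zO zT]. Qed.

Lemma weighted_L2 f : V0 f -> L2 muxt q (fun z => (rho0 z)^-1 * f z).
Proof.
move=> [[_ [fc _]] _].
have mQ : measurable (Q : set MXT) by exact: cylinder_measurable.
have mq : measurable (q : set MXT) by exact: cylinder_measurable.
have qoo : (muxt q < +oo)%E.
  apply: le_lt_trans (cylinder_finite_measure T oO bO).
  by apply: le_measure; rewrite ?inE//; exact: subcylinder.
have rB : bounded_measurable (Q : set MXT) (fun z => (rho0 z)^-1).
  have [cr rr _] := rho0_weight; split.
    apply: (@open_continuous_measurable_fun R XT _ MXT id Q (fun z => (rho0 z)^-1)).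
    - exact: open_measurable_xt.
    - exact: Q_open.
    move=> z zQ; apply: cvgV; last exact: cr.
    by rewrite gt_eqF// weight_gt0//; exact: set_mem.
  exists (rho_star^-1) => z zQ; have z0 := weight_gt0 zQ.
  rewrite ger0_norm; last by rewrite invr_ge0 ltW.
  rewrite lef_pV2 ?posrE//.
  exact: rr (mem_set zQ).
have [mf [M fM]] := bounded_measurableS mQ subcylinder
  (bounded_measurableM rB (cucQ_bounded_measurable fc)).
by apply: (L2_ess_bounded mq (M := M)) => //; apply: aeW => z; exact: fM.
Qed.

End operators.

(** * The dual problem *)

Lemma ereal_sup_subl {R : realType} (I : Type) (A : set I) (J : I -> R) (k : R) :
  (ereal_sup [set (k - J i)%:E | i in A] = - ereal_inf [set (J i)%:E | i in A] + k%:E)%E.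
Proof.
apply/eqP; rewrite eq_le; apply/andP; split.
  apply: ge_ereal_sup => _ [i Ai <-].
  rewrite addeC -leeBlDl// EFinB addeAC subee// add0e leeN2.
  by apply: ereal_inf_lbound; exists i.
rewrite -leeBrDr// leeNl; apply: le_ereal_inf_tmp => _ [i Ai <-].
rewrite leeNl leeBrDr// -EFinN -EFinD addrC.
by apply: ereal_sup_ubound; exists i.
Qed.

Section control.
Context {R : realType} {N : nat}.
Local Notation XT := ('rV[R]_N * R)%type.
Local Notation MXT := ('rV[measurableTypeR R]_N * measurableTypeR R)%type.
Local Notation mux := (lebesgue_rV R N).
Local Notation muxt := (lebesgue_xt R N).
Variables (Omega omega : set 'rV[R]_N) (T : R).
Hypotheses (oO : open Omega) (bO : bounded_set Omega).
Hypotheses (oomega : open omega) (oO_sub : omega `<=` Omega) (T0 : 0 < T).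
Variables (c : 'rV[R]_N -> 'M[R]_N) (d : XT -> R).
Hypothesis c_C1 : forall i j, Ck_closure 1 Omega (fun x => c x i j).
Hypothesis d_Linfty : Lp_on muxt (cylinder Omega T) +oo%E d.
Variables (rho_star : R) (rho0 : XT -> R).
Hypothesis rho_star0 : 0 < rho_star.
Hypothesis rho0_weight : weight_class Omega T rho_star rho0.
Variables (eps eta : R).
Hypotheses (eps0 : 0 < eps) (eta0 : 0 < eta).
Variables (Phi : completeNormedModType R) (ip_Phi : Phi -> Phi -> R).
Variable iota : (XT -> R) -> Phi.
Hypothesis Phi_completion : is_completion (Phi0 Omega T)
     (ip_Phi0 Omega omega T c d rho0 eps eta) ip_Phi iota.
Local Notation Q := (cylinder Omega T).
Local Notation q := (cylinder omega T).
Local Notation V0 := (Phi0 Omega T).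
Local Notation a := (a_form Omega omega T c d rho0 iota eps).
Local Notation b := (b_form Omega T c d iota).

Let weighted (f : XT -> R) (w : XT) := (rho0 w)^-1 * f w.
Let trace_T (f : XT -> R) (x : 'rV[R]_N) := f (x, T).
Let dot1 := L2_dot muxt (q : set MXT).
Let dot2 := L2_dot mux (Omega : set 'rV[measurableTypeR R]_N).
Let dot3 := L2_dot muxt (Q : set MXT).
Let E1 := extend Omega T iota muxt q weighted.
Let E2 := extend Omega T iota mux Omega trace_T.
Let E3 := extend Omega T iota muxt Q (Lstar c d).

Let mq : measurable (q : set MXT).
Proof.
by apply: open_measurable_xt; exact: open_cylinder.
Qed.
Let mO : measurable (Omega : set 'rV[measurableTypeR R]_N).
Proof. exact: open_measurable_x. Qed.
Let mQ : measurable (Q : set MXT).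
Proof. exact: cylinder_measurable. Qed.

Let V0_lin k f g : V0 f -> V0 g -> V0 (k *: f + g).
Proof. exact: Phi0_lin. Qed.

Let weighted_lin k f g : V0 f -> V0 g ->
  {in q, weighted (k *: f + g) =1 k *: weighted f + weighted g}.
Proof.
by move=> _ _ z _; rewrite /weighted !fctE /GRing.scale/= mulrDr mulrCA.
Qed.

Let rho0_neq0 z : q z -> rho0 z != 0.
Proof.
move=> qz; rewrite gt_eqF//; apply: (weight_gt0 rho_star0 rho0_weight).
exact: subcylinder qz.
Qed.

Lemma ip_Phi0E f g : ip_Phi0 Omega omega T c d rho0 eps eta f g =
  dot1 (weighted f) (weighted g) + eps * dot2 (trace_T f) (trace_T g) +
  eta * dot3 (Lstar c d f) (Lstar c d g).
Proof.
congr (_ + _ + _); apply: eq_Rintegral => z _.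
by rewrite /weighted -exprVn; move: (_^-1) => s; ring.
Qed.

Lemma a_formE r x y :
  a r x y = dot1 (E1 x) (E1 y) + eps * dot2 (E2 x) (E2 y) + r * dot3 (E3 x) (E3 y).
Proof.
congr (_ + _ + _); apply: eq_Rintegral => z zq.
rewrite /ext_q -/weighted -/E1; have := rho0_neq0 (set_mem zq).
by move: (rho0 z) (E1 x z) (E1 y z) => s u v s0; field.
Qed.

Let dot1_ge0 f : 0 <= dot1 f f. Proof. exact: L2_dot_ge0. Qed.
Let dot2_ge0 f : 0 <= dot2 f f. Proof. exact: L2_dot_ge0. Qed.
Let dot3_ge0 f : 0 <= dot3 f f. Proof. exact: L2_dot_ge0. Qed.

Let norm_iota f : V0 f -> `|iota f| ^+ 2 =
  dot1 (weighted f) (weighted f) + eps * dot2 (trace_T f) (trace_T f) +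
  eta * dot3 (Lstar c d f) (Lstar c d f).
Proof.
move=> Vf; rewrite (completion_norm Phi_completion).
by rewrite (completion_isometry Phi_completion)// ip_Phi0E.
Qed.

Let weighted_bd f : V0 f -> dot1 (weighted f) (weighted f) <= 1 * `|iota f| ^+ 2.
Proof.
move=> Vf; rewrite norm_iota// mul1r -addrA lerDl addr_ge0// mulr_ge0// ltW//.
Qed.

Let trace_bd f : V0 f -> dot2 (trace_T f) (trace_T f) <= eps^-1 * `|iota f| ^+ 2.
Proof.
move=> Vf; rewrite mulrC ler_pdivlMr// norm_iota// mulrC addrAC lerDr.
by rewrite addr_ge0// mulr_ge0// ltW.
Qed.

Let Lstar_bd f : V0 f -> dot3 (Lstar c d f) (Lstar c d f) <= eta^-1 * `|iota f| ^+ 2.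
Proof.
move=> Vf; rewrite mulrC ler_pdivlMr// norm_iota// mulrC lerDr.
by rewrite addr_ge0// mulr_ge0// ltW.
Qed.

Let iota_lin := completion_linear Phi_completion.
Let iota_dense := completion_dense Phi_completion.
Let weighted_L2' f : V0 f -> L2 muxt (q : set MXT) (weighted f).
Proof. exact: (weighted_L2 oO bO oomega oO_sub rho_star0 rho0_weight). Qed.
Let trace_L2' f : V0 f -> L2 mux (Omega : set 'rV[measurableTypeR R]_N) (trace_T f).
Proof. by apply: trace_L2 => //; rewrite lexx ltW. Qed.
Let Lstar_L2' f : V0 f -> L2 muxt (Q : set MXT) (Lstar c d f).
Proof. exact: Lstar_L2. Qed.
Let trace_lin k f g : V0 f -> V0 g ->
  {in Omega, trace_T (k *: f + g) =1 k *: trace_T f + trace_T g}.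
Proof. by []. Qed.
Let Lstar_lin' k f g : V0 f -> V0 g ->
  {in Q, Lstar c d (k *: f + g) =1 k *: Lstar c d f + Lstar c d g}.
Proof. exact: Lstar_lin. Qed.
Let eps'0 : 0 <= eps^-1. Proof. by rewrite invr_ge0 ltW. Qed.
Let eta'0 : 0 <= eta^-1. Proof. by rewrite invr_ge0 ltW. Qed.

Let E1_L2 := extend_L2 V0_lin iota_lin iota_dense
  mq ler01 weighted_lin weighted_L2' weighted_bd.
Let E2_L2 := extend_L2 V0_lin iota_lin iota_dense
  mO eps'0 trace_lin trace_L2' trace_bd.
Let E3_L2 := extend_L2 V0_lin iota_lin iota_dense
  mQ eta'0 Lstar_lin' Lstar_L2' Lstar_bd.
Let E1_lin := extend_dot_lin V0_lin iota_lin iota_dense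
  mq ler01 weighted_lin weighted_L2' weighted_bd.
Let E2_lin := extend_dot_lin V0_lin iota_lin iota_dense
  mO eps'0 trace_lin trace_L2' trace_bd.
Let E3_lin := extend_dot_lin V0_lin iota_lin iota_dense
  mQ eta'0 Lstar_lin' Lstar_L2' Lstar_bd.
Let E1_cvg := extend_dot_cvg V0_lin iota_lin iota_dense
  mq ler01 weighted_lin weighted_L2' weighted_bd.
Let E2_cvg := extend_dot_cvg V0_lin iota_lin iota_dense
  mO eps'0 trace_lin trace_L2' trace_bd.
Let E3_cvg := extend_dot_cvg V0_lin iota_lin iota_dense
  mQ eta'0 Lstar_lin' Lstar_L2' Lstar_bd.

Lemma a_formC r x y : a r x y = a r y x.
Proof.
by rewrite !a_formE; congr (_ + _ * _ + _ * _); exact: L2_dotC.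
Qed.

Lemma a_form_lin r k x y z : a r (k *: x + y) z = k * a r x z + a r y z.
Proof.
rewrite !a_formE /dot1 /dot2 /dot3 /E1 /E2 /E3 E1_lin; last exact: E1_L2.
rewrite E2_lin; last exact: E2_L2.
rewrite E3_lin; last exact: E3_L2.
ring.
Qed.

(** Both sides are the limit of [|iota (u n)|^2] along a sequence approximating
    [x]. This is what makes the forms comparable to the norm. *)
Lemma normE x : `|x| ^+ 2 = a eta x x.
Proof.
have [u ux] := approximates_exists iota_dense x; have [uV uc] := ux.
have c1 : `|iota (u n)| ^+ 2 @[n --> \oo] --> `|x| ^+ 2.
  under eq_fun do rewrite expr2; rewrite expr2.
  by apply: cvgM; exact: cvg_norm.
have c2 : `|iota (u n)| ^+ 2 @[n --> \oo] --> a eta x x.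
  rewrite a_formE (eq_cvg _ _ (fun n => norm_iota (uV n))).
  apply: cvgD; first apply: cvgD.
  - exact: E1_cvg.
  - by apply: cvgMr; exact: E2_cvg.
  - by apply: cvgMr; exact: E3_cvg.
exact: (cvg_unique (@Rhausdorff R) c1 c2).
Qed.

(** The forms for [r] and [eta] differ by the factor [r / eta] in one of their
    three nonnegative terms, which explains the constants here and below. *)
Lemma a_form_coercive r x : 0 < r ->
  Num.min 1 (r / eta) * `|x| ^+ 2 <= a r x x.
Proof.
move=> r0; rewrite normE !a_formE.
have m1 : Num.min 1 (r / eta) <= 1 by rewrite ge_min lexx.
have m2 : Num.min 1 (r / eta) * eta <= r.
  by rewrite -ler_pdivlMr// ge_min lexx orbT.
have h1 := dot1_ge0 (E1 x); have h2 := dot2_ge0 (E2 x); have h3 := dot3_ge0 (E3 x).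
move: (Num.min _ _) (dot1 _ _) (dot2 _ _) (dot3 _ _) m1 m2 h1 h2 h3.
by move=> m u v w m1 m2 u0 v0 w0; have := mulr_ge0 (ltW eps0) v0; nra.
Qed.

Lemma a_form_bounded r x : 0 < r ->
  a r x x <= Num.max 1 (r / eta) * `|x| ^+ 2.
Proof.
move=> r0; rewrite normE !a_formE.
have m1 : 1 <= Num.max 1 (r / eta) by rewrite le_max lexx.
have m2 : r <= Num.max 1 (r / eta) * eta.
  by rewrite -ler_pdivrMr// le_max lexx orbT.
have h1 := dot1_ge0 (E1 x); have h2 := dot2_ge0 (E2 x); have h3 := dot3_ge0 (E3 x).
move: (Num.max _ _) (dot1 _ _) (dot2 _ _) (dot3 _ _) m1 m2 h1 h2 h3.
by move=> m u v w m1 m2 u0 v0 w0; have := mulr_ge0 (ltW eps0) v0; nra.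
Qed.

Lemma a_form_ge0 r x : 0 < r -> 0 <= a r x x.
Proof.
move=> r0; rewrite a_formE !addr_ge0// mulr_ge0// ltW//.
Qed.

Lemma b_formE x lambda : b x lambda = - dot3 (E3 x) lambda.
Proof. by []. Qed.

(** The right-hand side is bounded with constant [|lambda|^2 / r], because
    [r |Lstar x|^2] is one of the terms of [a r x x]. *)
Lemma A_op_exists r lambda : 0 < r -> L2 muxt (Q : set MXT) lambda ->
  exists phi, forall psi, a r phi psi = - b psi lambda.
Proof.
move=> r0 lL.
have M0 : 0 <= r^-1 * dot3 lambda lambda by rewrite mulr_ge0// invr_ge0 ltW.
have m0 : 0 < Num.min 1 (r / eta) by rewrite lt_min ltr01 divr_gt0.
apply: (symmetric_lax_milgram (@a_formC r) (@a_form_lin r) _ m0 M0) => [k x y|x|x|x].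
- by rewrite !b_formE !opprK; exact: E3_lin.
- exact: a_form_coercive.
- exact: a_form_bounded.
rewrite b_formE opprK.
have cs := L2_cauchy_schwarz mQ (E3_L2 x) lL.
have : dot3 (E3 x) lambda ^+ 2 <= dot3 (E3 x) (E3 x) * dot3 lambda lambda.
  rewrite -real_normK ?num_real// /dot3 -!L2_norm_sqr -exprMn.
  by rewrite ler_sqr ?nnegrE ?mulr_ge0 ?L2_norm_ge0.
move/le_trans; apply; rewrite [leRHS]mulrAC ler_wpM2r//.
rewrite ler_pdivlMl// a_formE lerDr addr_ge0// mulr_ge0// ltW//.
Qed.

Section duality.
Variables (y0 : 'rV[R]_N -> R) (r : R) (phi0 : Phi).
Hypothesis r0 : 0 < r.
Hypothesis phi0_sol : forall psi, a r phi0 psi = l_form Omega T iota y0 psi.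
Local Notation L := (Lagrangian Omega omega T c d rho0 iota y0 eps r).
Local Notation J := (J_dual Omega omega T c d rho0 iota eps r phi0).

(** Completing the square: [- b _ lambda] is represented by [p] and the
    linear form by [phi0], so [L _ lambda] is minimal at [p + phi0]. *)
Lemma Lagrangian_square lambda : L2 muxt (Q : set MXT) lambda ->
  exists p, forall x, L x lambda =
    2^-1 * a r (x - (p + phi0)) (x - (p + phi0)) + (L phi0 (cst 0) - J lambda).
Proof.
move=> lL.
pose p := get [set phi : Phi | forall psi, a r phi psi = - b psi lambda].
have pP : forall psi, a r p psi = - b psi lambda.
  exact: (getPex (A_op_exists r0 lL)).
exists p => x.
have b0 : b phi0 (cst 0) = 0.
  rewrite b_formE /dot3 /L2_dot /Rintegral.
  by under eq_integral do rewrite mulr0; rewrite integral0 oppr0.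
have JE : J lambda = 2^-1 * a r p p + a r p phi0.
  rewrite /J_dual pP (pP phi0); congr (_ * _ + _); first by rewrite b_formE opprK.
have sq : a r (x - (p + phi0)) (x - (p + phi0)) =
    a r x x - 2 * (a r p x + a r phi0 x) + (a r p p + 2 * a r p phi0 + a r phi0 phi0).
  have -> : x - (p + phi0) = -1 *: (p + phi0) + x by rewrite scaleN1r addrC.
  have aC := @a_formC r; have aL := @a_form_lin r.
  rewrite (bilinear_sqrD aC aL) -[p + phi0]scale1r.
  have -> : 1 *: (p + phi0) = 1 *: p + phi0 by rewrite !scale1r.
  rewrite aL (bilinear_sqrD aC aL).
  by move: (a r p x) (a r phi0 x) (a r p p) (a r phi0 phi0) (a r p phi0) (a r x x)
    => u v w s t z; ring.
rewrite sq JE /Lagrangian b0 -!phi0_sol.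
have -> : b x lambda = - a r p x by rewrite pP opprK.
move: (a r p x) (a r phi0 x) (a r p p) (a r phi0 phi0) (a r p phi0) (a r x x).
by move=> u v w s t z; field.
Qed.

Lemma Lagrangian_inf lambda : L2 muxt (Q : set MXT) lambda ->
  ereal_inf [set (L phi lambda)%:E | phi in [set: Phi]] =
  (L phi0 (cst 0) - J lambda)%:E.
Proof.
move=> /Lagrangian_square[p LE]; apply/eqP; rewrite eq_le; apply/andP; split.
  apply: ereal_inf_lbound; exists (p + phi0) => //; rewrite LE subrr.
  have -> : a r 0 0 = 0 by have := a_form_lin r 1 0 0 0; rewrite scaler0 addr0; lra.
  by rewrite mulr0 add0r.
apply: le_ereal_inf_tmp => _ [x _ <-]; rewrite lee_fin LE lerDr mulr_ge0//.
exact: a_form_ge0.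
Qed.

End duality.
End control.

Theorem proposition2p2 (R : realType) (N : nat) (N_gt0 : (0 < N)%N)
  (Omega omega : set 'rV[R]_N) (T : R)
  (Omega_open : open Omega) (Omega_connected : connected Omega)
  (Omega_bounded : bounded_set Omega) (Omega_C2 : Ck_boundary 2 Omega)
  (omega_open : open omega) (omega_neq0 : omega !=set0)
  (omega_sub : omega `<=` Omega) (T_gt0 : 0 < T)
  (c : 'rV[R]_N -> 'M[R]_N) (c0 : R)
  (c_C1 : forall i j, Ck_closure 1 Omega (fun x => c x i j))
  (c0_gt0 : 0 < c0) (c_elliptic : elliptic Omega c c0)
  (d : 'rV[R]_N * R -> R)
  (d_Linfty : Lp_on (lebesgue_xt R N) (cylinder Omega T) +oo%E d)
  (rho_star : R) (rho_star_gt0 : 0 < rho_star)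
  (eps eta : R) (eps_gt0 : 0 < eps) (eta_gt0 : 0 < eta)
  (y0 : 'rV[R]_N -> R) (y0_L2 : L2 (lebesgue_rV R N) Omega y0)
  (rho0 : 'rV[R]_N * R -> R) (rho0_weight : weight_class Omega T rho_star rho0)
  (Phi : completeNormedModType R) (ip_Phi : Phi -> Phi -> R)
  (iota : ('rV[R]_N * R -> R) -> Phi)
  (Phi_completion : is_completion (Phi0 Omega T)
     (ip_Phi0 Omega omega T c d rho0 eps eta) ip_Phi iota)
  (r : R) (r_gt0 : 0 < r) (phi0 : Phi)
  (phi0_sol : forall psi : Phi,
     a_form Omega omega T c d rho0 iota eps r phi0 psi =
     l_form Omega T iota y0 psi) :
  let L := Lagrangian Omega omega T c d rho0 iota y0 eps r in
  let J := J_dual Omega omega T c d rho0 iota eps r phi0 in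
  let L2Q := L2 (lebesgue_xt R N) (cylinder Omega T) in
  (ereal_sup [set ereal_inf [set (L phi lambda)%:E | phi in [set: Phi]]
             | lambda in L2Q]
   = - ereal_inf [set (J lambda)%:E | lambda in L2Q] + (L phi0 (cst 0))%:E)%E.
Proof.
move=> L J L2Q; rewrite -ereal_sup_subl; congr ereal_sup.
apply: eq_imagel => lambda lL.
exact: (Lagrangian_inf Omega_open Omega_bounded omega_open omega_sub T_gt0 c_C1
  d_Linfty rho_star_gt0 rho0_weight eps_gt0 eta_gt0 Phi_completion r_gt0
  phi0_sol lL).
Qed.
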